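(* Let $X$ be a metrizable space. For each metric $d$ on $X$ of diameter $\le 1$ compatible with the topology, let $e=e_d:K(X)\to C_b(X)$ be the embedding given by $e(A)(x)=d(x,A)$. Then $e$ extends to an injective map $|K(X)|\to C_b(X)$, namely the affine extension $\sum_i\lambda_iA_i\mapsto\sum_i\lambda_i e(A_i)$, and the topology on the set $|K(X)|$ induced by this injection does not depend on the choice of the metric $d$. Moreover, this topology coincides with the topology of $|K(X)|_{HM}$ and with the topology of $|K(X)|_{AE}$.
   Context: $K(X)$ is the set of nonempty compact subsets of $X$, partially ordered by inclusion and topologized by the Hausdorff metric $d(A,B)=\max\big(\sup_{a\in A}d(a,B),\sup_{b\in B}d(A,b)\big)$ (its topology, the Vietoris topology, depends only on the topology of $X$). $C_b(X)$ is the vector space of bounded continuous functions $X\to\mathbb R$ with the norm $\|f\|=\sup_{x\in X}|f(x)|$; $d(x,A)=\inf_{a\in A}d(x,a)$. For a topological space $P$ that is also a poset, $|P|$ is the set of all formal sums $x=\sum_{i=1}^n\lambda_i x_i$, where $n\ge 1$, $x_1\le\dots\le x_n$ is a finite chain in $P$, each $\lambda_i\ge 0$ and $\sum_i\lambda_i=1$ (terms with zero coefficient may be dropped and terms with equal $x_i$ combined). $|P|_{HM}$ (for metrizable $P$): $x\in|P|$ is identified with the step function $\varphi_x:[0,1)\to P$, $\varphi_x(t)=x_k$ for $t\in\big[\sum_{i<k}\lambda_i,\sum_{i\le k}\lambda_i\big)$, and $|P|$ gets the topology of convergence in measure; for a bounded compatible metric $d$ on $P$ it is metrized by $L_1(\varphi,\psi)=\int_0^1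 d(\varphi(t),\psi(t))\,dt$. $|P|_{AE}$ (for metrizable $P$): $x\in|P|$ is identified with the finite probability measure $\mu_x=\sum\lambda_i\delta_{x_i}$, and $|P|$ gets the topology of the Kantorovich metric $\rho(\mu_x,\mu_y)=\inf\sum_k|\nu_k|\,d(p_k,q_k)$, the infimum being over all representations $\mu_x-\mu_y=\sum_{k=1}^r\nu_k(\delta_{p_k}-\delta_{q_k})$ with $p_k,q_k\in P$, $\nu_k\in\mathbb R$, where $d$ is a bounded compatible metric on $P$. *)

(* Defs.v *)
From HB Require Import structures.
From mathcomp Require Import all_boot all_order all_algebra.
From mathcomp Require Import all_classical all_reals all_analysis.

Set Implicit Arguments.
Unset Strict Implicit.
Unset Printing Implicit Defensive.

Import Order.TTheory GRing.Theory Num.Theory.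
Import numFieldNormedType.Exports.

Local Open Scope classical_set_scope.
Local Open Scope ring_scope.

(* Metrics are plain functions, because several metrics on the same space have
   to be compared; a topology is given by its family of open sets. *)
Section metrics.
Context {R : realType} {T : Type}.
Implicit Type D : T -> T -> R.

Definition is_metric D :=
  [/\ forall x y, D x y = 0 <-> x = y,
      forall x y, D x y = D y x &
      forall x y z, D x z <= D x y + D y z].

Definition metric_open D : set (set T) :=
  [set U | forall x, U x ->
     exists2 r, 0 < r & forall y, D x y < r -> U y].

Definition metrizes (tau : set (set T)) D := is_metric D /\ metric_open D = tau.

Definition bounded_metric D := exists M, forall x y, D x y <= M.

Lemma is_metric_ge0 D : is_metric D -> forall x y, 0 <= D x y.
Proof.
move=> [D0 Ds Dt] x y; rewrite -(@pmulrn_lge0 _ _ 2)//.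
have <- : D x x = 0 by apply/D0.
by rewrite mulr2n {2}Ds.
Qed.

End metrics.

Definition metrizable (R : realType) (X : topologicalType) :=
  exists d : X -> X -> R, metrizes open d.

Record unit_metric (R : realType) (X : topologicalType) := UnitMetric {
  unit_metric_fun :> X -> X -> R ;
  unit_metricP : metrizes open unit_metric_fun ;
  unit_metric_le1 : forall x y, unit_metric_fun x y <= 1 }.

Section point_set_distance.
Context {R : realType} {T : Type}.
Variable d : T -> T -> R.

Definition dist_set (x : T) (A : set T) : R := inf [set d x a | a in A].

Hypothesis dP : is_metric d.

Let dist_has_inf x A : A !=set0 -> has_inf [set d x a | a in A].
Proof.
move=> [a Aa]; split; first by exists (d x a), a.
by exists 0 => _ [b _ <-]; exact: is_metric_ge0.
Qed.

Lemma dist_set_ge0 x A : 0 <= dist_set x A.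
Proof.
rewrite /dist_set; have [A0|/nonemptyPn->] := pselect (A !=set0); last first.
  by rewrite image_set0 inf0.
apply: lb_le_inf; first by case: (dist_has_inf x A0).
by move=> _ [b _ <-]; exact: is_metric_ge0.
Qed.

Lemma dist_set_le x A a : A a -> dist_set x A <= d x a.
Proof.
move=> Aa; apply: ge_inf; last by exists a.
by apply: (dist_has_inf _ _).2; exists a.
Qed.

Lemma dist_set_triangle x y A :
  A !=set0 -> dist_set x A <= d x y + dist_set y A.
Proof.
move=> A0; have [_ _ dt] := dP; rewrite -lerBlDl.
apply: lb_le_inf; first by case: (dist_has_inf y A0).
move=> _ [a Aa <-]; rewrite lerBlDl.
exact: le_trans (dist_set_le _ Aa) (dt _ _ _).
Qed.

End point_set_distance.

Section bounded_continuous.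
Variables (R : realType) (X : topologicalType).

Definition Cb_pred : {pred X -> R^o} :=
  fun f => `[< continuous f /\ bounded_fun f >].

Record Cb := MkCb { Cb_fun :> X -> R^o ; Cb_funP : Cb_fun \in Cb_pred }.

HB.instance Definition _ := [isSub for Cb_fun].
HB.instance Definition _ := [Choice of Cb by <:].

Lemma Cb_continuous (f : Cb) : continuous f.
Proof. by have /asboolP[] := Cb_funP f. Qed.

Lemma Cb_bounded (f : Cb) : exists M, forall x, `|f x| <= M.
Proof.
have /asboolP[_] := Cb_funP f; move=> /(@filter_ex _ +oo%R)[M fM].
by exists M => x; exact: fM.
Qed.

Lemma Cb_predP (f : X -> R^o) :
  continuous f -> (exists M, forall x, `|f x| <= M) -> f \in Cb_pred.
Proof.
move=> cf [M fM]; apply/asboolP; split; first exact: cf.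
exists M; split; first exact: num_real.
by move=> N MN x _; exact: le_trans (fM x) (ltW MN).
Qed.

Fact Cb_submod_closed : submod_closed Cb_pred.
Proof.
split.
  by apply: Cb_predP; [move=> x; exact: cvg_cst|exists 0 => x; rewrite normr0].
move=> a f g fP gP.
have [M fM] := Cb_bounded (MkCb fP); have [N gN] := Cb_bounded (MkCb gP).
apply: Cb_predP => [x|].
  have cf := @Cb_continuous (MkCb fP) x; have cg := @Cb_continuous (MkCb gP) x.
  have := cvgD (cvgZl_tmp (k := a) cf) cg; exact.
exists (`|a| * M + N) => x; rewrite (le_trans (ler_normD _ _))// lerD//.
by rewrite normrM ler_wpM2l.
Qed.

HB.instance Definition _ := GRing.isSubmodClosed.Build R (X -> R^o) Cb_pred
  Cb_submod_closed.
HB.instance Definition _ := [SubChoice_isSubLmodule of Cb by <:].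

Definition sup_norm (f : Cb) : R := sup [set `|f x| | x in [set: X]].

Lemma sup_norm_ub (f : Cb) x : `|f x| <= sup_norm f.
Proof.
have [M fM] := Cb_bounded f; apply: ub_le_sup; last by exists x.
by exists M => _ [y _ <-].
Qed.

Lemma sup_norm_le (f : Cb) M :
  0 <= M -> (forall x, `|f x| <= M) -> sup_norm f <= M.
Proof.
move=> M0 fM; have [[x0 _]|X0] := pselect ([set: X] !=set0).
  by apply: ge_sup; [exists `|f x0|, x0|move=> _ [y _ <-]].
by move/nonemptyPn: X0 => X0; rewrite /sup_norm X0 image_set0 sup0.
Qed.

Lemma sup_norm_ge0 (f : Cb) : 0 <= sup_norm f.
Proof.
have [[x _]|/nonemptyPn X0] := pselect ([set: X] !=set0).
  exact: le_trans (sup_norm_ub f x).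
by rewrite /sup_norm X0 image_set0 sup0.
Qed.

Fact sup_normD f g : sup_norm (f + g) <= sup_norm f + sup_norm g.
Proof.
apply: sup_norm_le => [|x]; first by rewrite addr_ge0// sup_norm_ge0.
by rewrite (le_trans (ler_normD _ _))// lerD// sup_norm_ub.
Qed.

Fact sup_normZ (a : R) f : sup_norm (a *: f) = `|a| * sup_norm f.
Proof.
have le b g : sup_norm (b *: g) <= `|b| * sup_norm g.
  apply: sup_norm_le => [|x]; first by rewrite mulr_ge0// sup_norm_ge0.
  by rewrite normrM ler_wpM2l// sup_norm_ub.
have [->|a0] := eqVneq a 0.
  apply/eqP; rewrite eq_le le normr0 mul0r scale0r; exact: sup_norm_ge0.
apply/eqP; rewrite eq_le le/= -ler_pdivlMl ?normr_gt0//.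
by rewrite -normfV -{1}[f](scalerK a0) le.
Qed.

Fact sup_norm_eq0 f : sup_norm f = 0 -> f = 0.
Proof.
move=> f0; apply/val_inj/funext => x; apply/eqP.
by rewrite -normr_le0 -f0 sup_norm_ub.
Qed.

HB.instance Definition _ := Lmodule_isNormed.Build R Cb
  sup_normD sup_normZ sup_norm_eq0.

End bounded_continuous.

Section hyperspace.
Variable X : topologicalType.

Definition K_pred : {pred set X} := fun A => `[< A !=set0 /\ compact A >].

Record K := MkK { K_set :> set X ; K_setP : K_pred K_set }.

HB.instance Definition _ := [isSub for K_set].
HB.instance Definition _ := [Choice of K by <:].
HB.instance Definition _ := [SubChoice_isSubPOrder of K by <: with set_display].

Lemma leK (A B : K) : (A <= B)%O <-> A `<=` B.
Proof. by rewrite -subsetEset. Qed.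

Lemma K_neq0 (A : K) : A !=set0. Proof. by have /asboolP[] := K_setP A. Qed.

Lemma K_compact (A : K) : compact A.
Proof. by have /asboolP[] := K_setP A. Qed.

Definition hausdorff (R : realType) (d : X -> X -> R) (A B : K) : R :=
  Num.max (sup [set dist_set d a B | a in A])
          (sup [set dist_set d b A | b in B]).

End hyperspace.

Arguments hausdorff {X R}.

Section embedding.
Context {R : realType} {X : topologicalType}.
Variable d : unit_metric R X.

Fact emb_subproof (A : K X) : (dist_set d ^~ A : X -> R^o) \in @Cb_pred R X.
Proof.
have [dP dopen] := unit_metricP d; have [d0 ds dt] := dP.
have A0 := K_neq0 A; apply: Cb_predP.
  move=> x; apply/cvgrPdist_lt => e e0.
  have : nbhs x [set y | d x y < e].
    apply: open_nbhs_nbhs; split; last by rewrite /= (d0 x x).2.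
    rewrite -dopen => y /= xy; exists (e - d x y); first by rewrite subr_gt0.
    by move=> z yz; rewrite (le_lt_trans (dt x y z))// -ltrBrDl.
  apply: filterS => y /= xy; apply: le_lt_trans xy.
  rewrite ler_norml lerBlDr dist_set_triangle// andbT lerNl opprB lerBlDr.
  by rewrite ds dist_set_triangle.
exists 1 => x; rewrite ger0_norm ?dist_set_ge0//.
have [a Aa] := A0.
exact: le_trans (dist_set_le dP x Aa) (unit_metric_le1 _ _ _).
Qed.

Definition emb (A : K X) : Cb R X := MkCb (emb_subproof A).

End embedding.

(* A formal sum is a list of (coefficient, point) pairs.  Modulo dropping zero
   terms and combining terms with equal points, every formal sum along a weakly
   increasing chain has exactly one representative with positive coefficients
   and a strictly increasing chain (reduce_reduced, mass_reduce and mass_inj).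
   The realization |P| below is the type of these representatives. *)
Section realization.
Context {R : realType} {disp : Order.disp_t} {P : porderType disp}.
Implicit Types s : seq (R * P).

Definition chain_sum s :=
  [&& all (fun u => 0 <= u.1) s, sorted <=%O (unzip2 s)
    & \sum_(u <- s) u.1 == 1].

Definition reduced_sum s :=
  [&& all (fun u => 0 < u.1) s, sorted <%O (unzip2 s)
    & \sum_(u <- s) u.1 == 1].

(* the coefficient of p, i.e. the mass at p of the measure
   \sum_(u <- s) u.1 \d_(u.2) *)
Definition mass s (p : P) : R := \sum_(u <- s | u.2 == p) u.1.

Lemma reduced_chain s : reduced_sum s -> chain_sum s.
Proof.
move=> /and3P[s0 ss s1]; apply/and3P; split => //.
  by apply: sub_all s0 => u; exact: ltW.
by apply: sub_sorted ss => p q; exact: ltW.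
Qed.

Lemma mass_gt0 s : all (fun u => 0 < u.1) s ->
  forall p, (0 < mass s p) = (p \in unzip2 s).
Proof.
move=> + p; rewrite /mass; elim: s => [|[l q] s IH] /=.
  by rewrite big_nil ltxx.
move=> /andP[/= l0 /IH {}IH]; rewrite big_cons inE /= eq_sym.
have m0 : 0 <= \sum_(j <- s | j.2 == p) j.1.
  rewrite le_eqVlt IH; case: (boolP (p \in _)) => [_|ps]; first by rewrite orbT.
  rewrite orbF eq_sym big_seq_cond big1// => u /andP[us /eqP up].
  by rewrite -up (map_f snd us) in ps.
by case: eqP => _ //=; rewrite ltr_wpDr.
Qed.

Lemma mass_inj s t :
  reduced_sum s -> reduced_sum t -> mass s =1 mass t -> s = t.
Proof.
move=> /and3P[s0 ss _] /and3P[t0 ts _] st.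
have E : unzip2 s = unzip2 t.
  by apply: lt_sorted_eq => // p; rewrite -!mass_gt0// st.
have coefE r : sorted <%O (unzip2 r) -> r = [seq (mass r p, p) | p <- unzip2 r].
  move=> /lt_sorted_uniq; elim: r {s0 ss t0 ts st E} => // -[l q] r IH /=.
  move=> /andP[qr /IH {}IH]; rewrite /mass big_cons eqxx big_seq_cond big1.
    rewrite addr0; congr cons; rewrite {1}IH.
    apply/eq_in_map => p pr; congr pair; rewrite /mass big_cons /= ifF//.
    by apply: contraNF qr => /eqP ->.
  by move=> u /andP[ur /eqP uq]; rewrite -uq (map_f snd ur) in qr.
by rewrite (coefE s)// (coefE t)// E; apply/eq_map => p; rewrite st.
Qed.

Definition reduce s : seq (R * P) :=
  [seq (mass s p, p) | p <- undup (unzip2 [seq u <- s | 0 < u.1])].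

Lemma mass_reduce s : chain_sum s -> mass (reduce s) =1 mass s.
Proof.
move=> /and3P[s0 _ _] p; rewrite {1}/mass /reduce big_map /=.
set ps := undup _; have [pin|pout] := boolP (p \in ps).
  rewrite big_mkcond/= (bigD1_seq p) ?undup_uniq//= eqxx big1 ?addr0//.
  by move=> q /negPf->.
rewrite big_seq_cond big1; last first.
  by move=> q /andP[qps /eqP qp]; rewrite -qp qps in pout.
rewrite /mass big_seq_cond big1// => u /andP[us /eqP up].
apply/eqP; rewrite eq_le (allP s0 _ us) andbT leNgt.
apply: contra pout => u0; rewrite mem_undup -up.
by apply: map_f; rewrite mem_filter u0.
Qed.

Lemma reduce_reduced s : chain_sum s -> reduced_sum (reduce s).
Proof.
move=> sc; have /and3P[s0 ss /eqP s1] := sc.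
set ps := undup (unzip2 [seq u <- s | 0 < u.1]).
have zE : unzip2 (reduce s) = ps by rewrite /unzip2 -map_comp map_id.
apply/and3P; split.
- apply/allP => _ /mapP[p + ->] /=; rewrite mem_undup => /mapP[u].
  rewrite mem_filter => /andP[u0 us] ->; rewrite /mass.
  rewrite (perm_big _ (perm_to_rem us))/= big_cons eqxx ltr_wpDr// big_seq_cond.
  by apply: sumr_ge0 => v /andP[/mem_rem vs _]; exact: (allP s0).
- rewrite zE lt_sorted_uniq_le undup_uniq; apply: subseq_sorted ss.
    exact: le_trans.
  apply: subseq_trans (undup_subseq _) _.
  by apply: map_subseq; exact: filter_subseq.
- apply/eqP; rewrite -s1 big_map /= /mass.
  under eq_bigr do rewrite big_mkcond.
  rewrite exchange_big /= big_seq [RHS]big_seq; apply: eq_bigr => u us.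
  have [u0|u0] := ltP 0 u.1.
    rewrite (bigD1_seq u.2) ?undup_uniq//=; last first.
      by rewrite mem_undup; apply: map_f; rewrite mem_filter u0.
    by rewrite eqxx big1 ?addr0// => q /negPf; rewrite eq_sym => ->.
  have -> : u.1 = 0 by apply/eqP; rewrite eq_le u0 (allP s0).
  by rewrite big1// => q _; case: ifP.
Qed.

Lemma reduce_id s : reduced_sum s -> reduce s = s.
Proof.
move=> sr; have sc := reduced_chain sr.
by apply: mass_inj => //; [exact: reduce_reduced|exact: mass_reduce].
Qed.

End realization.

Section step_functions.
Context {R : realType} {P : eqType}.

(* The value is u_k.2 when t lies between the k-th and (k+1)-st partial sums of
   the coefficients (step_seqE); p0 is returned for t beyond the total. *)
Fixpoint step_seq (p0 : P) (s : seq (R * P)) (t : R) : P :=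
  if s is u :: s' then (if t < u.1 then u.2 else step_seq p0 s' (t - u.1))
  else p0.

Lemma step_seqE p0 s t k (u0 := (0, p0)) : all (fun u => 0 <= u.1) s ->
  (k < size s)%N ->
  \sum_(u <- take k s) u.1 <= t < \sum_(u <- take k.+1 s) u.1 ->
  step_seq p0 s t = (nth u0 s k).2.
Proof.
elim: s t k => [//|u s IH] t [|k] /= /andP[u0' s0] ks.
  by rewrite take0 big_nil big_seq1 => /andP[_ ->].
rewrite !big_cons => /andP[tk kt]; rewrite ifF; last first.
  apply/negbTE; rewrite -leNgt; apply: le_trans tk.
  rewrite lerDl big_seq; apply: sumr_ge0 => v /mem_take; exact: (allP s0).
by apply: IH => //; rewrite lerBrDl tk ltrBlDl.
Qed.

End step_functions.

Section geometric_realization.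
Variables (R : realType) (disp : Order.disp_t) (P : porderType disp).

Record realization := Realization {
  terms :> seq (R * P) ; terms_reduced : reduced_sum terms }.

HB.instance Definition _ := [isSub for terms].
HB.instance Definition _ := [Choice of realization by <:].

Definition formal_sum (s : seq (R * P)) (sc : chain_sum s) : realization :=
  Realization (reduce_reduced sc).

Lemma vertex_chain (p : P) : chain_sum [:: (1 : R, p)].
Proof. by rewrite /chain_sum /= ler01 big_seq1 eqxx. Qed.

Definition vertex (p : P) : realization := formal_sum (vertex_chain p).

Definition affine_ext (V : lmodType R) (f : P -> V) (x : realization) : V :=
  \sum_(u <- x) u.1 *: f u.2.

Implicit Types x y : realization.

Fact realization_point x : exists p, p \in unzip2 x.
Proof.
case: x => -[|[l p] s] /= => [/and3P[_ _]|_]; last first.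
  by exists p; rewrite inE eqxx.
by rewrite big_nil eq_sym oner_eq0.
Qed.

(* only the values on [0, 1[ are meaningful *)
Definition step_fun x (t : R) : P :=
  step_seq (xchoose (realization_point x)) x t.

Variable D : P -> P -> R.

(* The sets {y | mu{t | r < D (phi_x t) (phi_y t)} < r} for r > 0 are a basis of
   neighbourhoods of x for convergence in measure. *)
Definition conv_in_measure_open : set (set realization) :=
  [set U | forall x, U x -> exists2 r, 0 < r & forall y,
     (lebesgue_measure
        [set t : R | (0 <= t < 1)%R /\ (r < D (step_fun x t) (step_fun y t))%R]
        < r%:E)%E -> U y].

Definition L1_dist x y : R :=
  \int[lebesgue_measure]_(t in `[0, 1[) D (step_fun x t) (step_fun y t).

(* A finitely supported signed measure is identified with its point masses, so
   the equation is mu_x - mu_y = \sum_k nu_k (\d_(p_k) - \d_(q_k)). *)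
Definition kantorovich x y : R :=
  inf [set c | exists n (nu : 'I_n -> R) (p q : 'I_n -> P),
    (forall z, mass x z - mass y z =
       \sum_(k < n) nu k * ((p k == z)%:R - (q k == z)%:R)) /\
    c = \sum_(k < n) `|nu k| * D (p k) (q k)].

End geometric_realization.

Section induced_topology.
Context {R : realType} {X : topologicalType}.

Definition induced_open (d : unit_metric R X) :
    set (set (realization R (K X))) :=
  @open (initial_topology (affine_ext (emb d))).

End induced_topology.

(* Main.v *)
Require Import Defs.
From mathcomp Require Import all_boot all_order all_algebra.
From mathcomp Require Import all_classical all_reals all_analysis.
From mathcomp Require Import measurable_realfun lra ring.

Import Order.TTheory GRing.Theory Num.Theory.
Import numFieldNormedType.Exports.

Local Open Scope classical_set_scope.
Local Open Scope ring_scope.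
Set Implicit Arguments.
Unset Strict Implicit.

(** Write e(x) for the image of x in C_b(X), phi_x for the step function of x, and
    h for the Hausdorff metric of d.  All metrics below are compared on a
    coupling of x and y: a list of intervals on which both phi_x and phi_y are
    constant, given by lengths and pairs of values (coupling_exists).  On it
    the measure of the set where phi_x and phi_y are far apart, the L1 distance,
    and the values of e(x) and e(y) are finite sums, and it is also a transport
    plan, so the Kantorovich metric is at most the L1 metric.

    Since A |-> d(z, A) is 1-Lipschitz for h, the norm of e(x) - e(y) is at most
    the mean of h over the coupling.  The substance of the theorem is a converse
    (blocks_cost, norm_small_cost): when x has n terms and e(y) is close to
    e(x), the mean of h over the coupling is small, with a modulus depending on
    n only.  This uses that both chains increase.  Let A be a value of phi_x,
    taken on an interval [s, s'), and suppose that phi_x and phi_y are close in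
    mean before s.  At a in A the integrand d(a, phi_x(t)) vanishes from s on,
    so the integral of d(a, phi_y(t)) over t >= s is small; as it decreases in t,
    (t - s) d(a, phi_y(t)) is small.  At b in phi_y(t), with t < s', the integrand
    d(b, phi_y) vanishes from t on while d(b, phi_x) is at least d(b, A)
    until s'; hence (s' - t) d(b, A) is small too.  So phi_y(t) is close to A for
    t away from s and s', and one proceeds to the next value of phi_x.  With
    norm 0 in place of a small norm this also gives injectivity.

    For a metric D on K(X) equivalent to h, closeness for D and for h agree
    uniformly around the finitely many values of the fixed phi_x
    (refine_finite).  The norm topology is then contained in the Kantorovich
    topology of D by testing against Lipschitz regularizations of A |-> d(z, A)
    (kantorovich_lower); the Kantorovich topology in the L1 topology; the L1
    topology, for bounded D, in the topology of convergence in measure; and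
    the latter in the norm topology by the converse above.  Convergence in
    measure sees only the topology of K(X), which is the same for all
    compatible metrics on X (metric_open_hausdorff); so the norm topology does
    not depend on d. *)

(** * Weighted sums and point masses *)

Section weighted_sums.
Context {R : realType} {Q : eqType}.
Implicit Types (c : seq (R * Q)) (F G : Q -> R).

Lemma ler_wsum c F G : all (fun u => 0 <= u.1) c ->
  (forall u, u \in c -> F u.2 <= G u.2) ->
  \sum_(u <- c) u.1 * F u.2 <= \sum_(u <- c) u.1 * G u.2.
Proof.
move=> c0 FG; rewrite big_seq [leRHS]big_seq; apply: ler_sum => u uc.
by rewrite ler_wpM2l ?FG//; exact: (allP c0).
Qed.

Lemma wsum_ge0 c F : all (fun u => 0 <= u.1) c ->
  (forall u, u \in c -> 0 <= F u.2) -> 0 <= \sum_(u <- c) u.1 * F u.2.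
Proof.
move=> c0 F0; rewrite big_seq; apply: sumr_ge0 => u uc.
by rewrite mulr_ge0 ?F0//; exact: (allP c0).
Qed.

Lemma weight_ge0 c : all (fun u => 0 <= u.1) c -> 0 <= \sum_(u <- c) u.1.
Proof. by move=> c0; rewrite big_seq sumr_ge0// => u; exact: (allP c0). Qed.

(** The terms met before the running weight reaches eta weigh less than eta in
    all, and F is at most 1 there; on the other terms F is at most M. *)
Lemma prefix_wsum c F eta M : all (fun u => 0 <= u.1) c -> 0 <= eta -> 0 <= M ->
  (forall u, u \in c -> F u.2 <= 1) ->
  (forall l u r, c = l ++ u :: r -> eta <= \sum_(v <- l) v.1 + u.1 -> F u.2 <= M) ->
  \sum_(u <- c) u.1 * F u.2 <= eta + M * \sum_(u <- c) u.1.
Proof.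
elim: c eta => [|u c IH] eta; first by rewrite !big_nil mulr0 addr0.
move=> /= /andP[u0 c0] eta0 M0 F1 FM; rewrite !big_cons.
have [eu|ue] := leP eta u.1.
  suff : \sum_(v <- c) v.1 * F v.2 <= \sum_(v <- c) v.1 * M.
    rewrite -mulr_suml => cM; have := FM [::] u c erefl.
    rewrite big_nil add0r => /(_ eu) /(ler_wpM2l u0); lra.
  apply: (ler_wsum (G := fun=> M) c0) => v vc.
  have [l [r cE]] : exists l r, c = l ++ v :: r.
    by case/splitPr: vc => l r; exists l, r.
  apply: (FM (u :: l) v r); first by rewrite cE.
  move: c0; rewrite cE all_cat => /andP[l0 /= /andP[v0 _]].
  by rewrite big_cons -addrA (le_trans eu)// lerDl addr_ge0// weight_ge0.
have uF : u.1 * F u.2 <= u.1 by rewrite ler_piMr// F1// mem_head.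
have uM : 0 <= u.1 * M by rewrite mulr_ge0.
suff : \sum_(v <- c) v.1 * F v.2 <= (eta - u.1) + M * \sum_(v <- c) v.1 by lra.
apply: IH => //; first by rewrite subr_ge0 ltW.
  by move=> v vc; apply: F1; rewrite inE vc orbT.
move=> l v r cE lv; apply: (FM (u :: l) v r); first by rewrite cE.
by rewrite big_cons -addrA -lerBlDl.
Qed.

Lemma suffix_wsum c F eta M : all (fun u => 0 <= u.1) c -> 0 <= eta -> 0 <= M ->
  (forall u, u \in c -> F u.2 <= 1) ->
  (forall l u r, c = l ++ u :: r -> eta <= u.1 + \sum_(v <- r) v.1 -> F u.2 <= M) ->
  \sum_(u <- c) u.1 * F u.2 <= eta + M * \sum_(u <- c) u.1.
Proof.
move=> c0 eta0 M0 F1 FM.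
have revE (f : R * Q -> R) : \sum_(u <- c) f u = \sum_(u <- rev c) f u.
  by apply: perm_big; rewrite perm_sym perm_rev.
rewrite !revE; apply: prefix_wsum => //; first by rewrite all_rev.
  by move=> u; rewrite mem_rev; exact: F1.
move=> l u r /(congr1 rev); rewrite revK rev_cat rev_cons cat_rcons => cE lu.
apply: (FM (rev r) u (rev l) cE); rewrite addrC.
by rewrite (perm_big l)//= perm_rev.
Qed.

(** Convergence in measure controls the mean of a bounded F: at most r off the
    bad set, at most M on it. *)
Lemma wsum_le_exceed c F (bad : pred Q) r M : all (fun u => 0 <= u.1) c ->
  \sum_(u <- c) u.1 <= 1 -> 0 <= r -> 0 <= M ->
  (forall u, u \in c -> ~~ bad u.2 -> F u.2 <= r) ->
  (forall u, u \in c -> F u.2 <= M) ->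
  \sum_(u <- c) u.1 * F u.2 <= r + M * \sum_(u <- c | bad u.2) u.1.
Proof.
move=> c0 c1 r0 M0 Fr FM.
have : \sum_(u <- c) u.1 * F u.2 <=
       \sum_(u <- c) u.1 * (r + (if bad u.2 then M else 0)).
  apply: (ler_wsum (G := fun q => r + (if bad q then M else 0)) c0) => u uc.
  case: ifPn => ub; last by rewrite addr0 Fr.
  by rewrite (le_trans (FM u uc))// lerDr.
move=> /le_trans; apply.
under eq_bigr do rewrite mulrDr; rewrite big_split/= -mulr_suml lerD//.
  by rewrite -[leRHS]mul1r ler_wpM2r.
rewrite [X in _ <= _ * X]big_mkcond mulr_sumr; apply: ler_sum => u _.
by case: ifP => _; rewrite ?mulr0// mulrC.
Qed.

Lemma markov_wsum c F (bad : pred Q) s : all (fun u => 0 <= u.1) c ->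
  (forall u, u \in c -> 0 <= F u.2) ->
  (forall u, u \in c -> bad u.2 -> s <= F u.2) ->
  s * \sum_(u <- c | bad u.2) u.1 <= \sum_(u <- c) u.1 * F u.2.
Proof.
move=> c0 F0 Fs; rewrite mulr_sumr big_mkcond big_seq [leRHS]big_seq.
apply: ler_sum => u uc; have u0 := allP c0 _ uc.
by case: ifP => ub; rewrite 1?mulrC ?ler_wpM2l ?Fs// mulr_ge0 ?F0.
Qed.

End weighted_sums.

Section masses.
Context {R : realType} {disp : Order.disp_t} {P : porderType disp}.
Implicit Types s t : seq (R * P).

(** A combination of values depends only on the point masses.  This gives the
    value of an affine extension on unreduced formal sums, and the integral of
    a function against a finitely supported signed measure. *)
Lemma sum_by_mass (V : lmodType R) (k : P -> V) s (zs : seq P) : uniq zs ->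
  {subset unzip2 s <= zs} ->
  \sum_(u <- s) u.1 *: k u.2 = \sum_(z <- zs) mass s z *: k z.
Proof.
move=> zs_uniq szs; under [RHS]eq_bigr do rewrite /mass big_mkcond scaler_suml.
rewrite exchange_big /= big_seq [RHS]big_seq; apply: eq_bigr => u us.
rewrite (bigD1_seq u.2) ?szs ?map_f//= eqxx big1 ?addr0// => z zu.
by rewrite eq_sym (negPf zu) scale0r.
Qed.

Lemma eq_mass_sum (V : lmodType R) (k : P -> V) s t : mass s =1 mass t ->
  \sum_(u <- s) u.1 *: k u.2 = \sum_(u <- t) u.1 *: k u.2.
Proof.
move=> st; have zu : uniq (undup (unzip2 (s ++ t))) by exact: undup_uniq.
rewrite !(sum_by_mass _ zu); first by apply: eq_bigr => z _; rewrite st.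
  by move=> z; rewrite mem_undup /unzip2 map_cat mem_cat => ->; rewrite orbT.
by move=> z; rewrite mem_undup /unzip2 map_cat mem_cat => ->.
Qed.

Lemma reduced_ge0 (x : realization R P) : all (fun u => 0 <= u.1) x.
Proof. by have /reduced_chain/and3P[] := terms_reduced x. Qed.

Lemma reduced_sum1 (x : realization R P) : \sum_(u <- x) u.1 = 1.
Proof. by have /and3P[_ _ /eqP] := terms_reduced x. Qed.

End masses.

(** * Distances to compact sets and the Hausdorff metric *)

Section point_distance.
Context {R : realType} {T : Type} {d : T -> T -> R} (dP : is_metric d).
Implicit Types A B : set T.

Lemma dist_set_mem A a : A a -> dist_set d a A = 0.
Proof.
move=> Aa; apply/le_anti; rewrite dist_set_ge0// andbT.
by have [d0 _ _] := dP; rewrite (le_trans (dist_set_le dP a Aa))// (d0 a a).2.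
Qed.

Lemma dist_set_adherent x A e : A !=set0 -> 0 < e ->
  exists2 a, A a & d x a < dist_set d x A + e.
Proof.
move=> [a0 Aa0] e0; have [//||_ [a Aa <-] xa] := @inf_adherent _ [set d x a | a in A] e.
  split; first by exists (d x a0), a0.
  by exists 0 => _ [b _ <-]; exact: is_metric_ge0.
by exists a.
Qed.

Lemma dist_set_subset x A B : A !=set0 -> A `<=` B -> dist_set d x B <= dist_set d x A.
Proof.
move=> A0 AB; apply/ler_addgt0Pr => e e0.
have [a Aa /ltW] := dist_set_adherent x A0 e0.
by apply: le_trans; apply: dist_set_le => //; exact: AB.
Qed.

Lemma dist_set_le_excess x A B h : A !=set0 -> B !=set0 ->
  (forall b, B b -> dist_set d b A <= h) -> dist_set d x A <= dist_set d x B + h.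
Proof.
move=> A0 B0 Bh; apply/ler_addgt0Pr => e e0.
have [b Bb xb] := dist_set_adherent x B0 e0.
have := dist_set_triangle dP x b A0; have := Bh b Bb; lra.
Qed.

End point_distance.

Section hausdorff_distance.
Context {R : realType} {X : topologicalType}.

Lemma nbhs_metric_ball (d : X -> X -> R) x e : metrizes open d -> 0 < e ->
  nbhs x [set y | d x y < e].
Proof.
move=> [dP dopen] e0; have [d0 _ dt] := dP.
apply: open_nbhs_nbhs; split; last by rewrite /= (d0 x x).2.
rewrite -dopen => y /= xy; exists (e - d x y); first by rewrite subr_gt0.
by move=> z yz; rewrite (le_lt_trans (dt x y z))// -ltrBrDl.
Qed.

Lemma nbhs_metricP (d : X -> X -> R) x U : metrizes open d -> nbhs x U ->
  exists2 e, 0 < e & forall y, d x y < e -> U y.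
Proof.
move=> [dP dopen]; rewrite nbhsE => -[V [oV Vx] VU].
move: oV; rewrite -dopen => /(_ x Vx)[e e0 eV].
by exists e => // y /eV /VU.
Qed.

(** One half of the Hausdorff metric.  The two halves are estimated separately,
    because an inclusion between sets makes one of them vanish. *)
Definition excess (d : X -> X -> R) (A B : K X) : R :=
  sup [set dist_set d a B | a in A].

Lemma hausdorffE d A B : hausdorff d A B = Num.max (excess d A B) (excess d B A).
Proof. by []. Qed.

Variable (d : X -> X -> R).
Hypothesis dX : metrizes open d.
Let dP : is_metric d := dX.1.

(** The metric may be unbounded, so the suprema in the Hausdorff metric have to
    be shown finite; compactness of A does it. *)
Lemma dist_set_compact_bounded (A B : K X) :
  exists M, forall a, K_set A a -> dist_set d a B <= M.
Proof.
have [B0 [d0 ds dt]] := (K_neq0 B, dP).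
have cA := (compact_near_coveringP _).1 (K_compact (A := A)).
pose small M a := dist_set d a B <= M.
suff : \forall M \near +oo%R, K_set A `<=` small M.
  by move=> /filter_ex[M AM]; exists M => a; exact: AM.
apply: cA => a _; exists ([set y | d a y < 1], [set M | dist_set d a B + 1 <= M]).
  split; first exact: nbhs_metric_ball.
  by exists (dist_set d a B + 1); split => [|M /ltW//]; exact: num_real.
move=> [y M] /= [ay]; apply: le_trans; rewrite addrC.
by rewrite (le_trans (dist_set_triangle dP y a B0))// lerD2r ds ltW.
Qed.

Lemma dist_set_le_sup (A B : K X) a : K_set A a -> dist_set d a B <= excess d A B.
Proof.
move=> Aa; apply: ub_le_sup; last by exists a.
have [M AM] := dist_set_compact_bounded A B.
by exists M => _ [b Ab <-]; exact: AM.
Qed.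

Lemma excess_le (A B : K X) h : (forall a, K_set A a -> dist_set d a B <= h) ->
  excess d A B <= h.
Proof.
have [a0 Aa0] := K_neq0 A => Ah.
by apply: ge_sup; [exists (dist_set d a0 B), a0|move=> _ [a Aa <-]; exact: Ah].
Qed.

Lemma excess_ge0 (A B : K X) : 0 <= excess d A B.
Proof.
have [a Aa] := K_neq0 A.
by apply: le_trans (dist_set_le_sup B Aa); exact: dist_set_ge0.
Qed.

Lemma hausdorff_ge0 (A B : K X) : 0 <= hausdorff d A B.
Proof. by rewrite hausdorffE le_max excess_ge0. Qed.

Lemma hausdorff_le_excessD (A B : K X) :
  hausdorff d A B <= excess d A B + excess d B A.
Proof. by rewrite hausdorffE ge_max lerDl lerDr !excess_ge0. Qed.

Lemma dist_set_hausdorff x (A B : K X) :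
  `|dist_set d x A - dist_set d x B| <= hausdorff d A B.
Proof.
have [A0 B0] := (K_neq0 A, K_neq0 B).
rewrite ler_norml lerBlDl lerNl opprB lerBlDl; apply/andP; split.
  apply: dist_set_le_excess => // a Aa.
  by rewrite hausdorffE le_max dist_set_le_sup.
apply: dist_set_le_excess => // b Bb.
by rewrite hausdorffE le_max (dist_set_le_sup _ Bb) orbT.
Qed.

End hausdorff_distance.

Section hausdorff_is_metric.
Context {R : realType} {X : topologicalType}.
Variable d : X -> X -> R.
Hypothesis dX : metrizes open d.

(** Compactness of A keeps a point outside A at a positive distance from it. *)
Lemma dist_set_eq0 (A : K X) z : dist_set d z A = 0 -> K_set A z.
Proof.
move=> zA; apply: contrapT => Az; have [d0 ds dt] := dX.1.
have cA := (compact_near_coveringP _).1 (K_compact (A := A)).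
pose away r a := r <= d z a.
suff : \forall r \near 0^'+, K_set A `<=` away r.
  move=> Aaway; have [r [Ar r0]] := filter_ex (filterI Aaway (nbhs_right_gt 0)).
  have : r <= dist_set d z A.
    have [a Aa] := K_neq0 A; apply: lb_le_inf; first by exists (d z a), a.
    by move=> _ [b Ab <-]; exact: Ar.
  by rewrite zA leNgt r0.
apply: cA => a Aa.
have za : 0 < d z a.
  rewrite lt_neqAle (is_metric_ge0 dX.1) andbT eq_sym; apply/eqP => /d0 az.
  by apply: Az; rewrite az.
have s0 : 0 < d z a / 2 by rewrite divr_gt0.
exists ([set y | d a y < d z a / 2], [set s | s <= d z a / 2]).
  by split; [exact: nbhs_metric_ball|exact: nbhs_right_le].
move=> [y s] /= [ay sr]; have := dt z y a; rewrite (ds y a) /away; lra.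
Qed.

Lemma dist_set_inj (A B : K X) : dist_set d ^~ A =1 dist_set d ^~ B -> A = B.
Proof.
move=> AB; apply/val_inj/seteqP; split=> x Ax; apply: dist_set_eq0.
  by rewrite -AB (dist_set_mem dX.1 Ax).
by rewrite AB (dist_set_mem dX.1 Ax).
Qed.

Lemma hausdorff_is_metric : is_metric (hausdorff (X := X) d).
Proof.
split=> [A B|A B|A B C].
- split=> [AB0|->].
    apply: dist_set_inj => x; apply/eqP; rewrite -subr_eq0 -normr_le0 -AB0.
    exact: dist_set_hausdorff.
  apply/le_anti; rewrite hausdorff_ge0// andbT hausdorffE ge_max.
  by rewrite !excess_le// => b Bb; rewrite (dist_set_mem dX.1 Bb).
- by rewrite !hausdorffE maxC.
- rewrite hausdorffE ge_max; apply/andP; split; apply: excess_le => x Ax.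
    have := dist_set_hausdorff dX x B C; have := dist_set_hausdorff dX x A B.
    by rewrite !ler_norml (dist_set_mem dX.1 Ax) => /andP[? ?] /andP[? ?]; lra.
  have := dist_set_hausdorff dX x B C; have := dist_set_hausdorff dX x A B.
  by rewrite !ler_norml (dist_set_mem dX.1 Ax) => /andP[? ?] /andP[? ?]; lra.
Qed.

End hausdorff_is_metric.

Section hyperspace_topology.
Context {R : realType} {X : topologicalType}.
Implicit Types d : X -> X -> R.

(** A Lebesgue number argument: the identity from d to d' is continuous at each
    point of the compact set A, hence uniformly so along A. *)
Lemma uniform_refinement d d' (A : K X) e : metrizes open d -> metrizes open d' ->
  0 < e -> exists2 r, 0 < r &
    forall a x, K_set A a -> d a x < r -> d' a x < e.
Proof.
move=> dX d'X e0; have [[_ ds dt] [d'P _]] := (dX.1, d'X).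
have [_ d's d't] := d'P.
have cA := (compact_near_coveringP _).1 (K_compact (A := A)).
pose fine r a := forall x, d a x < r -> d' a x < e.
suff : \forall r \near 0^'+, K_set A `<=` fine r.
  move=> Afine; have [r [Ar r0]] := filter_ex (filterI Afine (nbhs_right_gt 0)).
  by exists r => // a x /Ar; exact.
apply: cA => a _; have e20 : 0 < e / 2 by rewrite divr_gt0.
have [r r0 ra] := nbhs_metricP dX (nbhs_metric_ball a d'X e20).
have r20 : 0 < r / 2 by rewrite divr_gt0.
exists ([set y | d a y < r / 2], [set s | s <= r / 2]).
  split; first exact: nbhs_metric_ball.
  by apply: nbhs_right_le.
move=> [y s] /= [ay sr] x yx.
have ay' : d' a y < e / 2 by apply: ra; lra.
have ax' : d' a x < e / 2 by apply: ra; have := dt a y x; lra.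
by have := d't y a x; rewrite (d's y a); lra.
Qed.

Lemma hausdorff_refinement d d' (A : K X) e : metrizes open d ->
  metrizes open d' -> 0 < e -> exists2 r, 0 < r &
    forall B, hausdorff d A B < r -> hausdorff d' A B < e.
Proof.
move=> dX d'X e0; have e20 : 0 < e / 2 by rewrite divr_gt0.
have [r r0 Ar] := uniform_refinement A dX d'X e20.
have [_ d's _] := d'X.1; have [_ ds _] := dX.1.
exists r => // B; rewrite !hausdorffE gt_max => /andP[AB BA].
suff [le1 le2] : excess d' A B <= e / 2 /\ excess d' B A <= e / 2.
  by rewrite gt_max; apply/andP; split; lra.
split; apply: excess_le => x Ax.
  have := le_lt_trans (dist_set_le_sup dX B Ax) AB; rewrite -subr_gt0 => rx.
  have [y By xy] := dist_set_adherent dX.1 x (K_neq0 B) rx.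
  apply: le_trans (dist_set_le d'X.1 _ By) (ltW _); apply: Ar => //; lra.
have := le_lt_trans (dist_set_le_sup dX A Ax) BA; rewrite -subr_gt0 => rx.
have [y Ay xy] := dist_set_adherent dX.1 x (K_neq0 A) rx.
apply: le_trans (dist_set_le d'X.1 _ Ay) (ltW _); rewrite d's.
by apply: Ar => //; rewrite ds; lra.
Qed.

Lemma metric_open_sub {T : Type} (rho sigma : T -> T -> R) :
  (forall x e, 0 < e -> exists2 r, 0 < r & forall y, sigma x y < r -> rho x y < e) ->
  metric_open rho `<=` metric_open sigma.
Proof.
move=> dom U oU x Ux; have [e e0 eU] := oU x Ux.
by have [r r0 re] := dom x e e0; exists r => // y /re /eU.
Qed.

Lemma metric_open_hausdorff d d' : metrizes open d -> metrizes open d' ->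
  metric_open (hausdorff d) = metric_open (hausdorff d').
Proof.
by move=> dX d'X; apply/seteqP; split; apply: metric_open_sub => A e;
  exact: hausdorff_refinement.
Qed.

Lemma metric_open_refine {T : Type} (rho sigma : T -> T -> R) x e :
  is_metric rho -> metric_open rho = metric_open sigma -> 0 < e ->
  exists2 r, 0 < r & forall y, sigma x y < r -> rho x y < e.
Proof.
move=> [r0 rs rt] rhoE e0.
have : metric_open rho [set y | rho x y < e].
  move=> y /= xy; exists (e - rho x y); first by rewrite subr_gt0.
  by move=> z yz; have := rt x y z; lra.
by rewrite rhoE => /(_ x); rewrite /= (r0 x x).2//; exact.
Qed.

(** Equivalent metrics need not be uniformly equivalent, but they are so around
    the finitely many terms of a fixed formal sum; this is why the choice of the
    metric on the hyperspace does not matter. *)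
Lemma refine_finite {T : eqType} (rho sigma : T -> T -> R) (s : seq T) e :
  is_metric rho -> metric_open rho = metric_open sigma -> 0 < e ->
  exists2 r, 0 < r & forall p q, p \in s -> sigma p q < r -> rho p q < e.
Proof.
move=> rhoP rhoE e0; elim: s => [|p s [r r0 sr]]; first by exists 1.
have [r' r'0 pr] := metric_open_refine p rhoP rhoE e0.
exists (Num.min r r'); first by rewrite lt_min r0.
move=> p' q; rewrite inE lt_min => /predU1P[->|p's] /andP[qr qr'].
  exact: pr.
exact: sr qr.
Qed.

End hyperspace_topology.

(** * Common refinement of two chains *)

Section common_refinement.
Context {R : realType} {disp : Order.disp_t} {P : porderType disp}.
Implicit Types (s t : seq (R * P)) (ps : seq (seq (R * P))).

Lemma step_seq_map {Q Q' : eqType} (f : Q -> Q') q (c : seq (R * Q)) (t : R) :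
  step_seq (f q) [seq (u.1, f u.2) | u <- c] t = f (step_seq q c t).
Proof. by elim: c t => //= u c IH t; rewrite IH; case: ifP. Qed.

(** t arises from s by cutting its intervals into shorter ones.  The
    consequences are recorded instead of the combinatorics of the cuts. *)
Record subdivides t s : Prop := Subdivides {
  subdivides_ge0 : all (fun u => 0 <= u.1) t ;
  subdivides_step : forall p0 a, 0 <= a -> step_seq p0 t a = step_seq p0 s a ;
  subdivides_sum : forall F : P -> R,
    \sum_(u <- t) u.1 * F u.2 = \sum_(u <- s) u.1 * F u.2 ;
  subdivides_sub : {subset unzip2 t <= unzip2 s} ;
  subdivides_chain : pairwise <=%O (unzip2 s) -> pairwise <=%O (unzip2 t) }.

Lemma subdivides_cons m q t s : 0 <= m -> subdivides t s ->
  subdivides ((m, q) :: t) ((m, q) :: s).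
Proof.
move=> m0 [t0 st sF sub ch]; split => /=.
- by rewrite m0.
- by move=> p0 a a0; case: ltP => // ma; rewrite st// subr_ge0.
- by move=> F; rewrite !big_cons sF.
- by move=> z; rewrite !inE => /orP[->//|/sub ->]; rewrite orbT.
- move=> /andP[/allP qs /ch ->]; rewrite andbT; apply/allP => z /sub; exact: qs.
Qed.

Lemma subdivides_split l m q t s : 0 <= l <= m -> subdivides t ((m - l, q) :: s) ->
  subdivides ((l, q) :: t) ((m, q) :: s).
Proof.
move=> /andP[l0 lm] [t0 st sF sub ch]; split => /=.
- by rewrite l0.
- move=> p0 a a0; case: ltP => [al|la]; first by rewrite (lt_le_trans al).
  rewrite st ?subr_ge0//= ltrBlDr subrK opprB addrA subrK.
  by [].
- by move=> F; rewrite !big_cons sF big_cons/=; ring.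
- by move=> z; rewrite !inE => /orP[->//|/sub]; rewrite inE.
- move=> qs; rewrite ch// andbT; apply/allP => z /sub; rewrite inE.
  by move=> /predU1P[->//|]; case/andP: qs => /allP + _; exact.
Qed.

(** Consecutive pieces of prescribed lengths ls can be taken off the front: the
    first interval either is long enough for the first length, and is cut
    there, or is used up entirely. *)
Lemma cut_exists (ls : seq R) s : all (fun l => 0 <= l) ls ->
  all (fun u => 0 <= u.1) s -> \sum_(l <- ls) l = \sum_(u <- s) u.1 ->
  exists2 ps, [seq \sum_(u <- p) u.1 | p <- ps] = ls & subdivides (flatten ps) s.
Proof.
elim: ls s => [|l ls IHl] s /=.
  move=> _ s0; rewrite big_nil => s_0; exists [::] => //.
  have z u : u \in s -> u.1 = 0.
    move=> us; apply/le_anti; rewrite (allP s0 u us) andbT s_0.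
    by rewrite (perm_big _ (perm_to_rem us))/= big_cons lerDl weight_ge0//;
      apply/allP => v /mem_rem; exact: (allP s0).
  split => //=.
  - move=> p0 a a0; elim: s z {s0 s_0} => //= u s IH z.
    rewrite z ?mem_head// ltNge a0 subr0; apply: IH => v vs.
    by rewrite z// inE vs orbT.
  - by move=> F; rewrite big_nil big_seq big1// => u /z ->; rewrite mul0r.
elim: s l => [|[m q] s IHs] l /=.
  move=> /andP[l0 ls0] _; rewrite big_nil big_cons => e.
  have ls_ge0 : 0 <= \sum_(i <- ls) i by rewrite big_seq sumr_ge0// => i /(allP ls0).
  have [//||ps psE pss] := IHl [::] ls0; rewrite ?big_nil//; first by lra.
  by exists ([::] :: ps) => //=; rewrite big_nil psE; congr cons; lra.
move=> /andP[l0 ls0] /andP[m0 s0]; rewrite !big_cons/= => e.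
have [lm|ml] := leP l m.
  have [||ps psE pss] := IHl ((m - l, q) :: s) ls0.
  - by rewrite /= subr_ge0 lm.
  - by rewrite big_cons/=; lra.
  - exists ([:: (l, q)] :: ps); rewrite /= ?big_seq1 ?psE//.
    by apply: subdivides_split; rewrite ?l0.
have [||] := IHs (l - m) _ s0.
- by rewrite /= subr_ge0 (ltW ml).
- by rewrite big_cons; lra.
move=> [|p ps] //= [pE psE] pss; exists (((m, q) :: p) :: ps).
  by rewrite /= big_cons pE psE; congr cons; rewrite /=; lra.
exact: subdivides_cons.
Qed.

(** Each b pairs a point of the first chain with the piece of the second chain
    lying over its interval.  Keeping these blocks visible allows an induction on
    the number of terms of the first chain. *)
Definition couples (bs : seq (P * seq (R * P))) : seq (R * (P * P)) :=
  flatten [seq [seq (u.1, (b.1, u.2)) | u <- b.2] | b <- bs].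

Lemma step_seq_const_cat p0 p s t (a : R) : all (fun u => 0 <= u.1) s -> 0 <= a ->
  step_seq p0 ([seq (u.1, p) | u <- s] ++ t) a =
  if a < \sum_(u <- s) u.1 then p else step_seq p0 t (a - \sum_(u <- s) u.1).
Proof.
elim: s a => [|u s IH] a /=; first by rewrite big_nil subr0 ltNge => _ ->.
move=> /andP[u0 s0] a0; rewrite big_cons; case: (ltP a u.1) => [au|ua].
  by rewrite (lt_le_trans au)// lerDl weight_ge0.
by rewrite IH ?subr_ge0// ltrBlDl opprD addrA.
Qed.

(** Replacing, over each interval of s, the piece by the constant value of s
    leaves a subdivision of s. *)
Lemma couples_left s ps : [seq \sum_(u <- p) u.1 | p <- ps] = unzip1 s ->
  all (fun u => 0 <= u.1) (flatten ps) ->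
  subdivides [seq (u.1, u.2.1) | u <- couples (zip (unzip2 s) ps)] s.
Proof.
elim: s ps => [|[l q] s IH] [|p ps] //= [pE psE]; rewrite all_cat => /andP[p0 ps0].
have [c0 st sF sub ch] := IH _ psE ps0.
rewrite /couples/= map_cat -map_comp/=.
have pq : {subset unzip2 [seq (u.1, q) | u <- p] <= [:: q]}.
  by move=> z; rewrite /unzip2 -map_comp => /mapP[u _ ->]; rewrite mem_head.
split.
- by rewrite all_cat c0 andbT all_map.
- by move=> z a a0 /=; rewrite step_seq_const_cat// pE; case: ltP => // la; rewrite st// subr_ge0.
- by move=> F; rewrite big_cat big_cons/= sF big_map/= -mulr_suml pE.
- move=> z; rewrite /unzip2 map_cat mem_cat inE => /orP[/pq|/sub ->].
    by rewrite inE => ->.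
  by rewrite orbT.
- rewrite /unzip2 /= => /andP[/allP qs /ch chs]; rewrite map_cat pairwise_cat chs andbT.
  apply/andP; split; first by apply/allrelP => y z /pq; rewrite inE => /eqP-> /sub /qs.
  elim: p {p0 pE pq} => //= u p ->; rewrite andbT; apply/allP => z.
  by rewrite -map_comp => /mapP[v _ ->].
Qed.

Lemma couples_right (s : seq P) ps : size s = size ps ->
  [seq (u.1, u.2.2) | u <- couples (zip s ps)] = flatten ps.
Proof.
elim: s ps => [|q s IH] [|p ps] //= [/IH sps]; rewrite /couples/= map_cat -sps.
by rewrite -map_comp/=; congr cat; rewrite -[RHS]map_id; apply: eq_map => -[].
Qed.

Definition couple_le (u v : R * (P * P)) :=
  (u.2.1 <= v.2.1)%O && (u.2.2 <= v.2.2)%O.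

(** c lists, in order, intervals on which both step functions are constant: lengths
    together with the two values.  Measure, integral and total mass
    over [0, 1) all become sums over c. *)
Record coupling (x y : realization R P) (c : seq (R * (P * P))) : Prop := Coupling {
  coupling_ge0 : all (fun u => 0 <= u.1) c ;
  coupling_sum1 : \sum_(u <- c) u.1 = 1 ;
  coupling_chain : pairwise couple_le c ;
  coupling_mem : forall u, u \in c -> u.2.1 \in unzip2 x ;
  coupling_left : forall F : P -> R,
    \sum_(u <- x) u.1 * F u.2 = \sum_(u <- c) u.1 * F u.2.1 ;
  coupling_right : forall F : P -> R,
    \sum_(u <- y) u.1 * F u.2 = \sum_(u <- c) u.1 * F u.2.2 ;
  coupling_step : forall p q a, 0 <= a ->
    step_seq (p, q) c a = (step_seq p x a, step_seq q y a) }.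

Lemma coupling_exists (x y : realization R P) :
  exists2 bs, size bs = size x & coupling x y (couples bs).
Proof.
have x0 := reduced_ge0 x; have y0 := reduced_ge0 y.
have x1 := reduced_sum1 x; have y1 := reduced_sum1 y.
have chainP (z : realization R P) : pairwise <=%O (unzip2 z).
  by rewrite -(sorted_pairwise le_trans); have /reduced_chain/and3P[] := terms_reduced z.
have [||ps psE psy] := @cut_exists (unzip1 x) y _ y0.
- by rewrite all_map.
- by rewrite big_map x1 y1.
have szE : size (unzip2 x) = size ps.
  by rewrite size_map -(size_map fst x) -[RHS](size_map (fun p => \sum_(u <- p) u.1)) psE.
have lx := couples_left psE (subdivides_ge0 psy).
have ry := couples_right szE.
exists (zip (unzip2 x) ps); first by rewrite size_zip -szE minnn size_map.
set c := couples _ in lx ry *.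
have c0 : all (fun u => 0 <= u.1) c by have := subdivides_ge0 lx; rewrite all_map.
have sumx F : \sum_(u <- x) u.1 * F u.2 = \sum_(u <- c) u.1 * F u.2.1.
  by rewrite -(subdivides_sum lx) big_map.
split => //.
- have := sumx (fun=> 1); rewrite -!mulr_suml !mulr1 x1 => <-//.
- have -> : pairwise couple_le c =
    pairwise [rel u v | (u.2.1 <= v.2.1)%O && (u.2.2 <= v.2.2)%O] c by [].
  rewrite (pairwise_relI (fun u v => (u.2.1 <= v.2.1)%O) (fun u v => (u.2.2 <= v.2.2)%O)).
  have := subdivides_chain lx (chainP x); have := subdivides_chain psy (chainP y).
  by rewrite -ry /unzip2 -!map_comp !pairwise_map => -> ->.
- move=> u uc; apply: (subdivides_sub lx); rewrite /unzip2 -map_comp.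
  exact: (map_f (fun u => u.2.1)).
- by move=> F; rewrite -(subdivides_sum psy) -ry big_map.
- move=> p q a a0; rewrite -(subdivides_step lx _ a0) -(subdivides_step psy _ a0) -ry.
  rewrite (step_seq_map (fun z : P * P => z.1) (p, q)).
  rewrite (step_seq_map (fun z : P * P => z.2) (p, q)).
  by case: step_seq.
Qed.

End common_refinement.

(** * Measure and integral of step functions *)

Section step_measure.
Context {R : realType} {Q : eqType}.
Variable q0 : Q.
Implicit Types (c : seq (R * Q)) (a : R).

Let step_cons u c a t : 0 <= u.1 ->
  step_seq q0 (u :: c) (t - a) =
  if t < a + u.1 then u.2 else step_seq q0 c (t - (a + u.1)).
Proof. by move=> u0; rewrite /= ltrBlDl opprD addrA. Qed.

(** The base point a runs along the line, so that the induction on c moves to the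
    next interval without translating sets. *)
Lemma measure_step_seq c (bad : pred Q) a : all (fun u => 0 <= u.1) c ->
  let S := [set t : R | a <= t < a + \sum_(u <- c) u.1 /\
                        bad (step_seq q0 c (t - a))] in
  measurable S /\ lebesgue_measure S = (\sum_(u <- c | bad u.2) u.1)%:E.
Proof.
elim: c a => [|u c IH] a /=.
  move=> _; rewrite !big_nil addr0 (_ : [set _ | _] = set0) ?measure0//.
  by apply/seteqP; split => // t /= [/andP[/le_lt_trans /[apply]]]; rewrite ltxx.
move=> /andP[u0 c0]; have [mS muS] := IH (a + u.1) c0; rewrite !big_cons.
have T0 := weight_ge0 c0.
set S' := [set t | _] in mS muS *.
pose I := if bad u.2 then `[a, a + u.1[%classic else set0 : set R.
have mI : measurable I by rewrite /I; case: ifP.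
have IS' : I `&` S' = set0.
  apply/seteqP; split => // t [It [/andP[]]]; move: It; rewrite /I.
  by case: ifP => //= _; rewrite in_itv/= => /andP[_ /lt_le_trans/[apply]]; rewrite ltxx.
have muI : lebesgue_measure I = (if bad u.2 then u.1 else 0)%:E.
  rewrite /I; case: ifP => _; last exact: measure0.
  rewrite lebesgue_measure_itv/= lte_fin ltrDl.
  case: ltP => [_|u0']; first by rewrite -EFinD addrAC subrr add0r.
  by congr EFin; apply/le_anti; rewrite u0.
rewrite (_ : [set _ | _] = I `|` S').
  split; first exact: measurableU.
  rewrite measureU//; rewrite [X in (X + _)%E = _]muI [X in (_ + X)%E = _]muS -EFinD.
  by case: ifP => _; rewrite ?add0r.
apply/seteqP; split => t /=.
  rewrite -/(step_seq q0 (u :: c) (t - a)) step_cons// addrA => -[/andP[at_ tb]].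
  case: ltP => [tu|ut] bt; last by right; rewrite /S'/= ut tb.
  by left; rewrite /I bt /= in_itv/= at_ tu.
rewrite -/(step_seq q0 (u :: c) (t - a)) step_cons// addrA.
case=> [|[/andP[ut tb] bt]].
  rewrite /I; case: ifP => //= bu; rewrite in_itv/= => /andP[at_ tu].
  by rewrite tu at_ bu (lt_le_trans tu)// lerDl.
by rewrite tb (le_trans _ ut) ?lerDl// ltNge ut.
Qed.

Lemma integral_step_seq c (g : Q -> R) a : all (fun u => 0 <= u.1) c ->
  (forall q, 0 <= g q) ->
  measurable_fun `[a, a + \sum_(u <- c) u.1[ (fun t : R => (g (step_seq q0 c (t - a)))%:E) /\
  (\int[lebesgue_measure]_(t in `[a, (a + \sum_(u <- c) u.1)%R[)
     (g (step_seq q0 c (t - a)%R))%:E)%E = (\sum_(u <- c) u.1 * g u.2)%:E.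
Proof.
move=> + g0; elim: c a => [|u c IH] a.
  move=> _ /=; rewrite !big_nil addr0 set_itvco0; split; first exact: measurable_fun_set0.
  by rewrite integral_set0.
move=> /= /andP[u0 c0]; have [mf If] := IH (a + u.1) c0.
have T0 := weight_ge0 c0.
set I' := `[_, _[%classic in mf If.
pose J : set R := `[a, a + u.1[%classic.
rewrite !big_cons (_ : [set` `[a, a + (u.1 + _)[] = J `|` I'); last first.
  apply/seteqP; split => t /=; rewrite in_itv/= ?addrA.
    move=> /andP[at_ tb]; case: (ltP t (a + u.1)) => tu; [left|right].
      by rewrite /J/= in_itv/= at_ tu.
    by rewrite /I'/= in_itv/= tu.
  rewrite /J /I'/= !in_itv/=.
  case=> /andP[le1 lt1]; first by rewrite le1 (lt_le_trans lt1)// lerDl.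
  by rewrite lt1 (le_trans _ le1)// lerDl.
set f := fun t : R => _.
have fJ : {in J, f =1 cst (g u.2)%:E}.
  move=> t; rewrite inE /J/= in_itv/= => /andP[_ tu].
  by rewrite /f ltrBlDl tu.
have fI : {in I', f =1 fun t => (g (step_seq q0 c (t - (a + u.1))))%:E}.
  move=> t; rewrite inE /I'/= in_itv/= => /andP[ut _].
  by rewrite /f ltrBlDl ltNge ut /= opprD addrA.
have mJ : measurable_fun J f.
  apply: (eq_measurable_fun (cst (g u.2)%:E)) => [t tJ|]; first by rewrite fJ.
  exact: measurable_cst.
have mI : measurable_fun I' f.
  apply: eq_measurable_fun mf => t tI.
  by rewrite fI.
have mU : measurable_fun (J `|` I') f.
  by apply/measurable_funU => //; [exact: measurable_itv|exact: measurable_itv].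
split=> //; transitivity (\int[lebesgue_measure]_(t in J) f t +
                          \int[lebesgue_measure]_(t in I') f t)%E.
  apply: ge0_integral_setU => //.
  - exact: measurable_itv.
  - exact: measurable_itv.
  - by move=> t _; rewrite lee_fin.
  - apply/disj_setPS => t []; rewrite /J /I' /= !in_itv/= => /andP[_ tu] /andP[ut _].
    by move: (lt_le_trans tu ut); rewrite ltxx.
rewrite EFinD; congr (_ + _)%E; last by rewrite -If; exact: eq_integral.
transitivity (\int[lebesgue_measure]_(t in J) cst (g u.2)%:E t)%E.
  exact: eq_integral.
rewrite integral_cst; last exact: measurable_itv.
rewrite [X in (_ * X)%E]lebesgue_measure_itv/= lte_fin ltrDl.
case: ltP => [_|u0']. rewrite -EFinD addrAC subrr add0r -EFinM mulrC.
  exact: erefl.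
have u00 : u.1 = 0 by apply/le_anti; rewrite u0 u0'.
by rewrite mule0 u00 mul0r.
Qed.

End step_measure.

(** * The three distances on a coupling *)

Section distances_by_coupling.
Context {R : realType} {disp : Order.disp_t} {P : porderType disp}.
Variable D : P -> P -> R.
Hypothesis DP : is_metric D.
Implicit Types x y : realization R P.

Let step_pair x y c a : coupling x y c -> 0 <= a ->
  step_seq (xchoose (realization_point x), xchoose (realization_point y)) c a =
  (step_fun x a, step_fun y a).
Proof. by move=> cP a0; rewrite (coupling_step cP). Qed.

Lemma measure_exceed x y c r : coupling x y c ->
  lebesgue_measure [set t : R | (0 <= t < 1)%R /\ (r < D (step_fun x t) (step_fun y t))%R]
  = (\sum_(u <- c | r < D u.2.1 u.2.2) u.1)%:E.
Proof.
move=> cP; have c0 := coupling_ge0 cP.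
set q0 := (xchoose (realization_point x), xchoose (realization_point y)).
have [_ <-] := measure_step_seq q0 (fun q => r < D q.1 q.2) 0 c0.
rewrite add0r (coupling_sum1 cP); congr lebesgue_measure.
apply/seteqP; split => t /= [/andP[t0 t1]]; rewrite subr0 (step_pair cP)//= => rD.
  by rewrite t0 t1.
by rewrite t0 t1.
Qed.

Lemma L1_dist_coupling x y c : coupling x y c ->
  L1_dist D x y = \sum_(u <- c) u.1 * D u.2.1 u.2.2.
Proof.
move=> cP; have c0 := coupling_ge0 cP.
set q0 := (xchoose (realization_point x), xchoose (realization_point y)).
have [|_] := integral_step_seq q0 (g := fun q => D q.1 q.2) 0 c0.
  by move=> q; exact: is_metric_ge0.
rewrite add0r (coupling_sum1 cP) => cE.
rewrite /L1_dist /Rintegral -[RHS]/(fine (_%:E)) -cE; congr fine.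
apply: eq_integral => t; rewrite inE /= in_itv/= => /andP[t0 _].
by rewrite subr0 (step_pair cP).
Qed.

(** The set whose infimum is kantorovich D x y. *)
Definition transport_costs x y (c : R) := exists n (nu : 'I_n -> R) (p q : 'I_n -> P),
  (forall z, mass x z - mass y z =
     \sum_(k < n) nu k * ((p k == z)%:R - (q k == z)%:R)) /\
  c = \sum_(k < n) `|nu k| * D (p k) (q k).

Lemma massE (s : seq (R * P)) z : mass s z = \sum_(u <- s) u.1 * (u.2 == z)%:R.
Proof.
by rewrite /mass big_mkcond; apply: eq_bigr => u _; case: eqP; rewrite ?mulr1 ?mulr0.
Qed.

Lemma transport_ge0 x y e : transport_costs x y e -> 0 <= e.
Proof.
move=> [n [nu [p [q [_ ->]]]]]; apply: sumr_ge0 => k _.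
by rewrite mulr_ge0//; exact: is_metric_ge0.
Qed.

(** A coupling is a transport plan: move the weight of each common interval from
    the first value to the second. *)
Lemma transport_coupling x y c : coupling x y c ->
  transport_costs x y (\sum_(u <- c) u.1 * D u.2.1 u.2.2).
Proof.
move=> cP; exists (size c), (fun k => (tnth (in_tuple c) k).1).
exists (fun k => (tnth (in_tuple c) k).2.1), (fun k => (tnth (in_tuple c) k).2.2).
split=> [z|].
  rewrite !massE (coupling_left cP (fun p => (p == z)%:R)).
  rewrite (coupling_right cP (fun p => (p == z)%:R)) -sumrB big_tnth.
  by apply: eq_bigr => k _; rewrite mulrBr.
rewrite big_tnth; apply: eq_bigr => k _.
by rewrite ger0_norm// (allP (coupling_ge0 cP))// mem_tnth.
Qed.

Lemma kantorovich_coupling x y c : coupling x y c ->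
  kantorovich D x y <= \sum_(u <- c) u.1 * D u.2.1 u.2.2.
Proof.
move=> cP; apply: ge_inf; last exact: transport_coupling.
by exists 0 => e /transport_ge0.
Qed.

(** The easy half of Kantorovich duality: integrating k against a representation
    of mu_x - mu_y bounds the difference of the integrals by C times its cost. *)
Lemma lipschitz_kantorovich x y (k : P -> R) C : 0 <= C ->
  (forall p q, k p - k q <= C * D p q) ->
  \sum_(u <- x) u.1 * k u.2 - \sum_(u <- y) u.1 * k u.2 <= C * kantorovich D x y.
Proof.
move=> C0 kC; have [_ Ds _] := DP.
have plan e : transport_costs x y e ->
    \sum_(u <- x) u.1 * k u.2 - \sum_(u <- y) u.1 * k u.2 <= C * e.
  move=> [n [nu [p [q [xyE ->]]]]].
  have xE : mass x =1 mass (y ++ [seq (nu i, p i) | i <- index_enum 'I_n] ++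
                           [seq (- nu i, q i) | i <- index_enum 'I_n]).
    move=> z; rewrite !massE !big_cat !big_map/= -!massE -big_split/=.
    apply/eqP; rewrite addrC -subr_eq xyE; apply/eqP; apply: eq_bigr => i _.
    by rewrite mulrBr mulNr.
  have /= -> := eq_mass_sum (V := R^o) k xE.
  rewrite !big_cat !big_map/= addrAC subrr add0r -big_split/= mulr_sumr.
  apply: ler_sum => i _; rewrite /GRing.scale/= mulNr -mulrBr mulrCA.
  apply: le_trans (ler_norm _) _; rewrite normrM ler_wpM2l//.
  by rewrite ler_norml kC andbT lerNl opprB Ds.
have [bs _ cP] := coupling_exists x y.
have [C00|C0'] := eqVneq C 0.
  by have := plan _ (transport_coupling cP); rewrite C00 !mul0r.
have C_gt0 : 0 < C by rewrite lt_neqAle eq_sym C0'.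
rewrite mulrC -ler_pdivrMr//; apply: lb_le_inf.
  by eexists; exact: transport_coupling cP.
by move=> e /plan; rewrite ler_pdivrMr// mulrC.
Qed.

(** The function g need not be Lipschitz for D; only its variation near the
    points p of x is controlled.  Its regularization k, the maximum over these p of
    g(p) - D(., p) / s and 0, is Lipschitz with constant 1/s, is at least g at
    the points of x, and at most g + e everywhere: where D(., p) >= s the term
    of p is not positive because g <= 1. *)
Lemma kantorovich_lower x y (g : P -> R) e s : 0 < e -> 0 < s ->
  (forall p q, p \in unzip2 x -> D p q < s -> g p - g q <= e) ->
  (forall p, 0 <= g p <= 1) ->
  \sum_(u <- x) u.1 * g u.2 - \sum_(u <- y) u.1 * g u.2 <=
  s^-1 * kantorovich D x y + e.
Proof.
move=> e0 s0 gs g01; have [D0 Ds Dt] := DP; have si0 : 0 < s^-1 by rewrite invr_gt0.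
pose k p := \big[Num.max/0]_(A <- unzip2 x) (g A - s^-1 * D p A).
have k0 p : 0 <= k p by exact: bigmax_ge_id.
have k_ge p A : A \in unzip2 x -> g A - s^-1 * D p A <= k p.
  by move=> Ax; exact: (@le_bigmax_seq _ _ _ _ 0 A xpredT (fun A => g A - s^-1 * D p A)).
have kL p q : k p - k q <= s^-1 * D p q.
  rewrite lerBlDl [k p]/k big_seq; apply: bigmax_le => [|A Ax].
    by rewrite addr_ge0 ?mulr_ge0 ?is_metric_ge0// ltW.
  have := k_ge q A Ax; have := ler_wpM2l (ltW si0) (Dt q p A).
  by rewrite mulrDr (Ds q p); lra.
have kg p : k p <= g p + e.
  have /andP[gp0 gp1] := g01 p.
  rewrite /k big_seq; apply: bigmax_le => [|A Ax]; first by lra.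
  have D_ge0 : 0 <= s^-1 * D p A by rewrite mulr_ge0 ?is_metric_ge0// ltW.
  have [Dps|sDp] := ltP (D A p) s.
    have := gs A p Ax Dps; lra.
  have : 1 <= s^-1 * D p A by rewrite Ds mulrC ler_pdivlMr// mul1r.
  by have /andP[? ?] := g01 A; lra.
have gk A : A \in unzip2 x -> g A <= k A.
  by move=> Ax; have := k_ge A A Ax; rewrite (D0 A A).2// mulr0 subr0.
have := lipschitz_kantorovich x y (ltW si0) kL.
have : \sum_(u <- x) u.1 * g u.2 <= \sum_(u <- x) u.1 * k u.2.
  apply: ler_wsum (reduced_ge0 x) _ => u ux; exact/gk/map_f.
have : \sum_(u <- y) u.1 * k u.2 <= \sum_(u <- y) u.1 * g u.2 + e.
  have := @ler_wsum _ _ y k (fun p => g p + e) (reduced_ge0 y) (fun u _ => kg u.2).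
  move=> /le_trans; apply; under eq_bigr do rewrite mulrDr.
  by rewrite big_split/= -mulr_suml reduced_sum1 mul1r.
lra.
Qed.

End distances_by_coupling.

(** * Two increasing chains with close affine images *)

Section coupled_chains.
Context {R : realType} {X : topologicalType}.
Variable d : unit_metric R X.
Implicit Types c l r : seq (R * (K X * K X)).

Let dX : metrizes open d := unit_metricP d.
Let dP : is_metric d := dX.1.

(** The mean Hausdorff distance between the two coupled chains. *)
Definition couple_cost c : R := \sum_(u <- c) u.1 * hausdorff d u.2.1 u.2.2.

(** The values at x of the affine extensions of the two coupled formal sums. *)
Definition left_dist c x : R := \sum_(u <- c) u.1 * dist_set d x u.2.1.

Definition right_dist c x : R := \sum_(u <- c) u.1 * dist_set d x u.2.2.

Lemma dist_set_le1 x (A : K X) : dist_set d x A <= 1.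
Proof.
have [a Aa] := K_neq0 A.
exact: le_trans (dist_set_le dP x Aa) (unit_metric_le1 _ _ _).
Qed.

Lemma excess_le1 (A B : K X) : excess d A B <= 1.
Proof. by apply: excess_le => a _; exact: dist_set_le1. Qed.

Lemma hausdorff_le1 (A B : K X) : hausdorff d A B <= 1.
Proof. by rewrite hausdorffE ge_max !excess_le1. Qed.

Lemma couple_cost_ge0 c : all (fun u => 0 <= u.1) c -> 0 <= couple_cost c.
Proof.
move=> c0; apply: (wsum_ge0 (F := fun q => hausdorff d q.1 q.2)) => // u _.
exact: hausdorff_ge0.
Qed.

Lemma left_right_dist c x : all (fun u => 0 <= u.1) c ->
  `|left_dist c x - right_dist c x| <= couple_cost c.
Proof.
move=> c0; rewrite /left_dist /right_dist -sumrB.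
rewrite (le_trans (ler_norm_sum _ _ _))// big_seq [leRHS]big_seq.
apply: ler_sum => u uc; have u0 := allP c0 u uc.
by rewrite -mulrBr normrM ger0_norm// ler_wpM2l// dist_set_hausdorff.
Qed.

Lemma left_dist_cat c c' x : left_dist (c ++ c') x = left_dist c x + left_dist c' x.
Proof. exact: big_cat. Qed.

Lemma right_dist_cat c c' x :
  right_dist (c ++ c') x = right_dist c x + right_dist c' x.
Proof. exact: big_cat. Qed.

Lemma right_dist_cons u c x :
  right_dist (u :: c) x = u.1 * dist_set d x u.2.2 + right_dist c x.
Proof. exact: big_cons. Qed.

Lemma left_dist_ge0 c x : all (fun u => 0 <= u.1) c -> 0 <= left_dist c x.
Proof.
move=> c0; apply: (wsum_ge0 (F := fun q : K X * K X => dist_set d x q.1)) => // u _.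
exact: dist_set_ge0.
Qed.

Lemma right_dist_ge0 c x : all (fun u => 0 <= u.1) c -> 0 <= right_dist c x.
Proof.
move=> c0; apply: (wsum_ge0 (F := fun q : K X * K X => dist_set d x q.2)) => // u _.
exact: dist_set_ge0.
Qed.

Lemma left_dist0 c (A : K X) a : K_set A a ->
  (forall u, u \in c -> (A <= u.2.1)%O) -> left_dist c a = 0.
Proof.
move=> Aa Ac; rewrite /left_dist big_seq big1// => u /Ac /leK Au.
by rewrite dist_set_mem ?mulr0//; exact: Au.
Qed.

Lemma right_dist0 c (B : K X) b : K_set B b ->
  (forall u, u \in c -> (B <= u.2.2)%O) -> right_dist c b = 0.
Proof.
move=> Bb Bc; rewrite /right_dist big_seq big1// => u /Bc /leK Bu.
by rewrite dist_set_mem ?mulr0//; exact: Bu.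
Qed.

Lemma left_dist_const c (A : K X) x : (forall u, u \in c -> u.2.1 = A) ->
  left_dist c x = (\sum_(u <- c) u.1) * dist_set d x A.
Proof.
move=> cA; rewrite /left_dist mulr_suml big_seq [RHS]big_seq.
by apply: eq_bigr => u /cA ->.
Qed.

(** The block c2 is the part of the coupling lying over one term A of the first
    chain, after the part c1 on which the two chains are already known to be
    close.  Testing the hypothesis c_close at points of A, and at points of the
    sets coupled with A, bounds the cost of c2 in terms of rho. *)
Section one_block.
Variables (c1 c2 c3 : seq (R * (K X * K X))) (A : K X) (delta : R).
Let c := c1 ++ c2 ++ c3.
Hypotheses (c_ge0 : all (fun u => 0 <= u.1) c) (c_le1 : \sum_(u <- c) u.1 <= 1).
Hypothesis c_chain : pairwise couple_le c.
Hypothesis c2A : forall u, u \in c2 -> u.2.1 = A.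
Hypothesis c_close : forall x, `|left_dist c x - right_dist c x| <= delta.

Let rho := delta + couple_cost c1.

Let parts_ge0 : [/\ all (fun u => 0 <= u.1) c1, all (fun u => 0 <= u.1) c2 &
  all (fun u => 0 <= u.1) c3].
Proof. by move: c_ge0; rewrite !all_cat => /and3P. Qed.

Let block_le1 : \sum_(u <- c2) u.1 <= 1.
Proof.
have [p1 p2 p3] := parts_ge0.
by move: c_le1 (weight_ge0 p1) (weight_ge0 p3); rewrite !big_cat/=; lra.
Qed.

Let rho_ge0 : 0 <= rho.
Proof.
have [x _] := K_neq0 A; have [p1 _ _] := parts_ge0.
by rewrite addr_ge0 ?couple_cost_ge0// (le_trans _ (c_close x)).
Qed.

Section one_term.
Variables (l r : seq (R * (K X * K X))) (u : R * (K X * K X)).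
Hypothesis c2E : c2 = l ++ u :: r.

Let uA : u.2.1 = A. Proof. by apply: c2A; rewrite c2E mem_cat mem_head orbT. Qed.

Let chain : [/\ forall v, v \in l -> v.2.1 = A /\ (v.2.2 <= u.2.2)%O,
  forall v, v \in r -> v.2.1 = A /\ (u.2.2 <= v.2.2)%O &
  forall v, v \in c3 -> (A <= v.2.1)%O /\ (u.2.2 <= v.2.2)%O].
Proof.
move: c_chain; rewrite /c c2E pairwise_cat -catA pairwise_cat cat_cons pairwise_cons.
case/and3P => _ _ /and4P[/allrelP lu _ + _]; rewrite all_cat => /andP[ur u3].
split => v vin.
- split; first by apply: c2A; rewrite c2E mem_cat vin.
  by have /andP[] := lu v u vin (mem_head _ _).
- split; first by apply: c2A; rewrite c2E mem_cat inE vin !orbT.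
  by have /andP[] := allP ur v vin.
- by rewrite -uA; exact/andP/(allP u3).
Qed.

Let terms_ge0 : [/\ all (fun v => 0 <= v.1) l, 0 <= u.1 & all (fun v => 0 <= v.1) r].
Proof. by have [_ + _] := parts_ge0; rewrite c2E all_cat => /andP[-> /= /andP[]]. Qed.

(** At a point a of A the sets of the first chain contribute nothing from the
    block on, so the second chain contributes little there: at most delta plus
    the discrepancy of c1. *)
Lemma right_dist_block a : K_set A a ->
  right_dist l a + u.1 * dist_set d a u.2.2 <= rho.
Proof.
move=> Aa; have [p1 p2 p3] := parts_ge0; have [l0 u0 r0] := terms_ge0.
have [_ _ chain3] := chain.
have := c_close a; have := left_right_dist a p1.
rewrite /c !left_dist_cat !right_dist_cat (@left_dist0 c2 _ _ Aa) => [|v /c2A->//].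
rewrite (@left_dist0 c3 _ _ Aa) => [|v /chain3[]//].
rewrite c2E right_dist_cat right_dist_cons /rho.
have := right_dist_ge0 a r0; have := right_dist_ge0 a p3.
by rewrite !ler_norml => ? ? /andP[? ?] /andP[? ?]; lra.
Qed.

(** The sets of the second chain increase, so every term before u is at least as
    far from a as u is; right_dist_block bounds the sum of these distances. *)
Lemma prefix_excess : (\sum_(v <- l) v.1 + u.1) * excess d A u.2.2 <= rho.
Proof.
have [l0 u0 r0] := terms_ge0; have [chainl _ _] := chain.
have w0 : 0 <= \sum_(v <- l) v.1 + u.1 by rewrite addr_ge0// weight_ge0.
have [w_gt0|w_le0] := ltP 0 (\sum_(v <- l) v.1 + u.1); last first.
  have -> : \sum_(v <- l) v.1 + u.1 = 0 by apply/le_anti; rewrite w_le0.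
  by rewrite mul0r.
rewrite mulrC -ler_pdivlMr//; apply: excess_le => a Aa.
rewrite ler_pdivlMr// mulrC; apply: le_trans (right_dist_block Aa).
rewrite mulrDl lerD2r mulr_suml.
apply: (ler_wsum (F := fun=> dist_set d a u.2.2)
                 (G := fun q : K X * K X => dist_set d a q.2)) => // v /chainl[_ vu].
by apply: dist_set_subset; [exact: dP|exact: K_neq0|exact/leK].
Qed.

(** At a point b of the set B coupled with A in u, the second chain contributes
    nothing from u on, whereas the first chain contributes at least d(b, A) for
    each of the remaining terms of the block.  The terms before u contribute
    about the same on both sides: d(b, B') <= d(b, a) + d(a, B') with a nearly
    closest to b in A, and the sum of the d(a, B') is at most rho. *)
Lemma suffix_excess : (u.1 + \sum_(v <- r) v.1) * excess d u.2.2 A <= 2 * rho.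
Proof.
have [l0 u0 r0] := terms_ge0; have [chainl chainr chain3] := chain.
have [p1 p2 p3] := parts_ge0; have [_ _ dt] := dP.
have w0 : 0 <= u.1 + \sum_(v <- r) v.1 by rewrite addr_ge0// weight_ge0.
have [w_gt0|w_le0] := ltP 0 (u.1 + \sum_(v <- r) v.1); last first.
  have -> : u.1 + \sum_(v <- r) v.1 = 0 by apply/le_anti; rewrite w_le0.
  by rewrite mul0r mulr_ge0.
rewrite mulrC -ler_pdivlMr//; apply: excess_le => b Bb.
rewrite ler_pdivlMr// mulrC; apply/ler_addgt0Pr => e e0.
have [a Aa ba] := dist_set_adherent dP b (K_neq0 A) e0.
have lw1 : \sum_(v <- l) v.1 <= 1.
  by move: block_le1; rewrite c2E big_cat big_cons/=; lra.
have lb : right_dist l b <=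
    (\sum_(v <- l) v.1) * dist_set d b A + e + right_dist l a.
  have : right_dist l b <= (\sum_(v <- l) v.1) * d b a + right_dist l a.
    rewrite /right_dist mulr_suml -big_split/=.
    under [leRHS]eq_bigr do rewrite -mulrDr.
    apply: (ler_wsum (F := fun q : K X * K X => dist_set d b q.2)
                     (G := fun q : K X * K X => d b a + dist_set d a q.2)) => // v _.
    by apply: dist_set_triangle; [exact: dP|exact: K_neq0].
  have lw0 := weight_ge0 l0.
  have := ler_wpM2l lw0 (ltW ba); rewrite mulrDr.
  have : (\sum_(v <- l) v.1) * e <= e by rewrite ler_piMl// ltW.
  lra.
have la : right_dist l a <= rho.
  apply: le_trans (right_dist_block Aa).
  by rewrite lerDl mulr_ge0// dist_set_ge0.
have := c_close b; have := left_right_dist b p1.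
rewrite /c !left_dist_cat !right_dist_cat (@left_dist_const c2 A)//.
rewrite (@right_dist0 c3 _ _ Bb) => [|v /chain3[]//].
rewrite c2E right_dist_cat right_dist_cons (dist_set_mem dP Bb) mulr0 add0r.
rewrite (@right_dist0 r _ _ Bb) => [|v /chainr[]//].
have := left_dist_ge0 b p3; rewrite big_cat big_cons/= mulrDl.
by rewrite !ler_norml /rho => ? /andP[? ?] /andP[? ?]; rewrite /rho in la; lra.
Qed.

End one_term.

(** The two previous bounds are weak only for terms of prefix or suffix weight
    below eta, and these weigh at most 2 * eta together. *)
Lemma block_cost eta : 0 < eta -> couple_cost c2 <= 2 * eta + 3 * rho / eta.
Proof.
move=> eta0; have [_ p2 _] := parts_ge0.
have r0 := rho_ge0.
have re0 : 0 <= rho / eta by rewrite divr_ge0// ltW.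
pose alpha (q : K X * K X) := excess d q.1 q.2.
pose beta (q : K X * K X) := excess d q.2 q.1.
have le_alpha : \sum_(u <- c2) u.1 * alpha u.2 <=
    eta + rho / eta * \sum_(u <- c2) u.1.
  apply: prefix_wsum => //; [exact: ltW|by move=> u _; exact: excess_le1|].
  move=> l u r c2E lu; rewrite ler_pdivlMr// mulrC.
  apply: le_trans (prefix_excess c2E); rewrite /alpha c2A; last first.
    by rewrite c2E mem_cat mem_head orbT.
  by rewrite ler_wpM2r// excess_ge0.
have le_beta : \sum_(u <- c2) u.1 * beta u.2 <=
    eta + 2 * rho / eta * \sum_(u <- c2) u.1.
  apply: suffix_wsum => //; [exact: ltW|by lra|by move=> u _; exact: excess_le1|].
  move=> l u r c2E ur; rewrite ler_pdivlMr// mulrC.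
  apply: le_trans (suffix_excess c2E); rewrite /beta c2A; last first.
    by rewrite c2E mem_cat mem_head orbT.
  by rewrite ler_wpM2r// excess_ge0.
have : couple_cost c2 <= \sum_(u <- c2) u.1 * (alpha u.2 + beta u.2).
  apply: (ler_wsum (F := fun q => hausdorff d q.1 q.2)
                   (G := fun q => alpha q + beta q)) => // u _.
  exact: hausdorff_le_excessD.
under eq_bigr do rewrite mulrDr; rewrite big_split/=.
have : rho / eta * \sum_(u <- c2) u.1 <= rho / eta by rewrite ler_piMr.
have : 2 * rho / eta = 2 * (rho / eta) by rewrite mulrA.
have -> : 3 * rho / eta = 3 * (rho / eta) by rewrite mulrA.
move=> E ?; rewrite E in le_beta; lra.
Qed.

End one_block.
End coupled_chains.

(** * The affine embedding and the comparison of topologies *)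

Section block_induction.
Context {R : realType} {X : topologicalType}.
Variable d : unit_metric R X.

(** Applying block_cost to one term of the first chain after the other.  The
    prefix c1 collects the blocks already treated; it is harmless as long as its
    cost is below the modulus needed for the n remaining blocks. *)
Lemma blocks_cost n e : 0 < e -> exists2 delta, 0 < delta &
  forall (bs : seq (K X * seq (R * K X))) c1, size bs = n ->
  let c := c1 ++ couples bs in
  all (fun u => 0 <= u.1) c -> \sum_(u <- c) u.1 <= 1 -> pairwise couple_le c ->
  (forall x, `|left_dist d c x - right_dist d c x| <= delta) ->
  couple_cost d c1 <= delta -> couple_cost d (couples bs) <= e.
Proof.
elim: n e => [|n IH] e e0.
  exists 1 => // -[|//] c1 _ /= _ _ _ _ _.
  by rewrite /couple_cost big_nil ltW.
have e20 : 0 < e / 2 by rewrite divr_gt0.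
have [delta' delta'0 IHd] := IH _ e20.
(* m is the cost allowed to the first block: eta = m / 4 and
   rho <= 2 * delta <= m^2 / 24 give 2 * eta + 3 * rho / eta <= m *)
pose m := Num.min (e / 2) (delta' / 2).
have m0 : 0 < m by rewrite lt_min e20 divr_gt0.
have me : m <= e / 2 by rewrite ge_min lexx.
have md : m <= delta' / 2 by rewrite ge_min lexx orbT.
pose delta := Num.min (delta' / 2) (m * m / 48).
have d1 : delta <= delta' / 2 by rewrite ge_min lexx.
have d2 : delta <= m * m / 48 by rewrite ge_min lexx orbT.
exists delta; first by rewrite lt_min !divr_gt0// mulr_gt0.
move=> [//|[A p] bs] c1 [sz]; rewrite /couples /= -/(couples bs).
set c2 := [seq _ | _ <- _] => c0 c_1 cch clo cost1.
have c2A u : u \in c2 -> u.2.1 = A by move=> /mapP[v _ ->].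
have eta0 : 0 < m / 4 by rewrite divr_gt0.
have := block_cost c0 c_1 cch c2A clo eta0.
set rho := delta + _ => cost2.
have rm : 3 * rho / (m / 4) <= m / 2.
  rewrite ler_pdivrMr//; have -> : m / 2 * (m / 4) = 6 * (m * m / 48) by field.
  by rewrite /rho; lra.
have cost2m : couple_cost d c2 <= m by lra.
have catE c c' : couple_cost d (c ++ c') = couple_cost d c + couple_cost d c'.
  exact: big_cat.
rewrite catE; suff : couple_cost d (couples bs) <= e / 2 by lra.
apply: (IHd bs (c1 ++ c2)) => //; rewrite -?catA//.
  by move=> x; rewrite (le_trans (clo x))//; lra.
by rewrite catE; lra.
Qed.

End block_induction.

Section normed_pullback.
Context {R : realType}.

Lemma open_initial_norm (T : choiceType) (V : normedModType R) (f : T -> V) :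
  @open (initial_topology f) = metric_open (fun x y => `|f x - f y|).
Proof.
apply/seteqP; split=> U.
  move=> [W oW <-] x /= Wx; have /nbhs_ballP[r /= r0 rW] := open_nbhs_nbhs (conj oW Wx).
  exists r => // y xy; apply: rW; rewrite -ball_normE /=.
  exact: xy.
move=> oU; exists (\bigcup_(x in U) [set v | exists2 r, 0 < r & `|f x - v| < r /\
    (forall y, `|f x - f y| < r -> U y)]).
  rewrite openE => v [x Ux [r r0 [xv rU]]]; apply/nbhs_ballP.
  exists (r - `|f x - v|); first by rewrite /= subr_gt0.
  move=> w; rewrite -ball_normE /= => vw; exists x => //; exists r => //; split=> //.
  by have := ler_distD v (f x) w; lra.
apply/seteqP; split=> [y [x Ux [r r0 [xy]]]|x Ux]; first exact.
have [r r0 rU] := oU x Ux; exists x => //; exists r => //.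
by rewrite subrr normr0.
Qed.

End normed_pullback.

Section affine_embedding.
Context {R : realType} {X : topologicalType}.
Variable d : unit_metric R X.
Let dX : metrizes open d := unit_metricP d.
Let E := affine_ext (R := R) (emb d).
Implicit Types x y : realization R (K X).

Lemma affine_embE x z : E x z = \sum_(u <- x) u.1 * dist_set d z u.2.
Proof.
rewrite /E /affine_ext; elim: (terms x) => [|u s IH]; first by rewrite !big_nil.
by rewrite !big_cons -IH.
Qed.

Lemma norm_embB (A B : K X) : `|emb d A - emb d B| = hausdorff d A B.
Proof.
apply/le_anti/andP; split.
  apply: sup_norm_le => [|z]; first exact: hausdorff_ge0.
  exact: dist_set_hausdorff.
have ub z : `|dist_set d z A - dist_set d z B| <= `|emb d A - emb d B|.
  exact: (sup_norm_ub (emb d A - emb d B)).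
rewrite hausdorffE ge_max; apply/andP; split; apply: excess_le => a Aa.
  apply: le_trans (ub a); rewrite (dist_set_mem dX.1 Aa) add0r normrN.
  exact: ler_norm.
apply: le_trans (ub a); rewrite (dist_set_mem dX.1 Aa) subr0.
exact: ler_norm.
Qed.

Lemma norm_affine_lt x y z e : `|E x - E y| < e ->
  `|\sum_(u <- x) u.1 * dist_set d z u.2 - \sum_(u <- y) u.1 * dist_set d z u.2| < e.
Proof.
apply: le_lt_trans; rewrite -!affine_embE.
exact: (sup_norm_ub (E x - E y)). Qed.

Lemma norm_affine_le x y e : 0 <= e -> (forall z,
  `|\sum_(u <- x) u.1 * dist_set d z u.2 - \sum_(u <- y) u.1 * dist_set d z u.2| <= e) ->
  `|E x - E y| <= e.
Proof.
move=> e0 xy; apply: sup_norm_le => // z.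
by have := xy z; rewrite -!affine_embE.
Qed.

Lemma coupling_dist x y c z : coupling x y c ->
  \sum_(u <- x) u.1 * dist_set d z u.2 - \sum_(u <- y) u.1 * dist_set d z u.2 =
  left_dist d c z - right_dist d c z.
Proof.
move=> cP; congr (_ - _); first exact: (coupling_left cP (fun A => dist_set d z A)).
exact: (coupling_right cP (fun A => dist_set d z A)).
Qed.

Lemma norm_small_cost n e : 0 < e -> exists2 delta, 0 < delta &
  forall x y bs, size bs = n -> coupling x y (couples bs) -> `|E x - E y| < delta ->
  couple_cost d (couples bs) <= e.
Proof.
move=> e0; have [delta delta0 small] := blocks_cost d n e0.
exists delta => // x y bs sz cP xy; apply: (small bs [::]) => //=.
- exact: coupling_ge0 cP.
- by rewrite (coupling_sum1 cP).
- exact: coupling_chain cP.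
- by move=> z; rewrite -(coupling_dist _ cP); exact/ltW/norm_affine_lt.
- by rewrite /couple_cost big_nil ltW.
Qed.

(** If the images agree, every coupling has cost 0, so it carries weight only where
    its two sets coincide; hence the point masses agree. *)
Lemma affine_emb_inj : injective E.
Proof.
move=> x y xyE; have [bs _ cP] := coupling_exists x y.
have c0 := coupling_ge0 cP.
have cost0 : couple_cost d (couples bs) <= 0.
  apply/ler_addgt0Pr => e e0; rewrite add0r.
  have [delta delta0 small] := norm_small_cost (size bs) e0.
  by apply: (small x y) => //; rewrite xyE subrr normr0.
have term0 u : u \in couples bs -> u.1 = 0 \/ u.2.1 = u.2.2.
  move=> uc; have u0 := allP c0 u uc.
  have : u.1 * hausdorff d u.2.1 u.2.2 <= 0.
    apply: le_trans cost0; rewrite /couple_cost (perm_big _ (perm_to_rem uc))/=.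
    rewrite big_cons lerDl; apply: couple_cost_ge0.
    by apply/allP => v /mem_rem; exact: (allP c0).
  rewrite le_eqVlt ltNge mulr_ge0 ?hausdorff_ge0// orbF mulf_eq0.
  move=> /orP[/eqP->|/eqP h0]; [by left|right].
  by have [h_eq0 _ _] := hausdorff_is_metric dX; exact/h_eq0.
apply/val_inj/mass_inj; [exact: terms_reduced|exact: terms_reduced|move=> p].
rewrite !massE (coupling_left cP (fun A => (A == p)%:R)).
rewrite (coupling_right cP (fun A => (A == p)%:R)) big_seq [RHS]big_seq.
by apply: eq_bigr => u /term0[->|->//]; rewrite !mul0r.
Qed.

Lemma affine_emb_formal_sum (s : seq (R * K X)) (sc : chain_sum s) :
  E (formal_sum sc) = \sum_(u <- s) u.1 *: emb d u.2.
Proof. exact/eq_mass_sum/mass_reduce. Qed.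

Lemma affine_emb_vertex (A : K X) : E (vertex R A) = emb d A.
Proof. by rewrite affine_emb_formal_sum big_seq1 scale1r. Qed.

End affine_embedding.

Section comparison.
Context {R : realType} {X : topologicalType}.
Variable d : unit_metric R X.
Let dX : metrizes open d := unit_metricP d.
Let E := affine_ext (R := R) (emb d).
Variable D : K X -> K X -> R.
Hypothesis DX : metrizes (metric_open (hausdorff d)) D.
Let DP : is_metric D := DX.1.
Implicit Types x y : realization R (K X).

Let hE : metric_open (hausdorff d) = metric_open D := esym DX.2.
Let hP : is_metric (hausdorff (X := X) d) := hausdorff_is_metric dX.

(** The distance to a set is 1-Lipschitz in the set for the Hausdorff metric, so the
    norm is at most the mean Hausdorff distance, which is small when the exceptional
    set is, the Hausdorff metric being bounded by 1. *)
Lemma norm_sub_measure :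
  metric_open (fun x y => `|E x - E y|) `<=` conv_in_measure_open D.
Proof.
move=> U oU x Ux; have [e e0 eU] := oU x Ux.
have e30 : 0 < e / 3 by rewrite divr_gt0.
have [s s0 sh] := refine_finite (unzip2 x) hP hE e30.
exists (Num.min (s / 2) (e / 3)); first by rewrite lt_min e30 divr_gt0.
set r := Num.min _ _ => y; have [bs _ cP] := coupling_exists x y.
rewrite (measure_exceed _ _ cP) lte_fin => bad_r; apply: eU.
have rs : r <= s / 2 by rewrite ge_min lexx.
have re : r <= e / 3 by rewrite ge_min lexx orbT.
suff : couple_cost d (couples bs) <= 2 * e / 3.
  move=> ce; apply: (@le_lt_trans _ _ (2 * e / 3)); last by lra.
  apply: norm_affine_le => [|z]; first by lra.
  by rewrite (coupling_dist _ _ cP) (le_trans _ ce)// left_right_dist// (coupling_ge0 cP).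
have := @wsum_le_exceed _ _ (couples bs) (fun q => hausdorff d q.1 q.2)
  (fun q => r < D q.1 q.2) (e / 3) 1 (coupling_ge0 cP).
rewrite (coupling_sum1 cP) mul1r => /(_ (lexx _) (ltW e30) ler01) cost.
rewrite /couple_cost; apply: le_trans (cost _ _) _ => [u uc|u uc|].
- rewrite -leNgt => Du; apply: ltW; apply: sh; first exact: coupling_mem cP _ uc.
  lra.
- exact: hausdorff_le1.
- by move: bad_r => /=; lra.
Qed.

(** By the Markov inequality, a small mean Hausdorff distance leaves little weight
    to pairs that are far apart, for the Hausdorff metric and hence for D. *)
Lemma measure_sub_norm :
  conv_in_measure_open D `<=` metric_open (fun x y => `|E x - E y|).
Proof.
move=> U oU x Ux; have [r r0 rU] := oU x Ux.
have [s s0 sD] := refine_finite (unzip2 x) DP (esym hE) r0.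
have e0 : 0 < s * r / 2 by rewrite divr_gt0// mulr_gt0.
have [delta delta0 small] := norm_small_cost d (size x) e0.
exists delta => // y xy; apply: rU; have [bs sz cP] := coupling_exists x y.
rewrite (measure_exceed _ _ cP) lte_fin.
have := @markov_wsum _ _ (couples bs) (fun q => hausdorff d q.1 q.2)
  (fun q => r < D q.1 q.2) s (coupling_ge0 cP).
move=> /(_ (fun u _ => hausdorff_ge0 dX _ _)) cost.
have {cost} : s * \sum_(u <- couples bs | r < D u.2.1 u.2.2) u.1 <= s * r / 2.
  apply: le_trans (cost _) (small x y bs sz cP xy) => u uc.
  by apply: contraTT; rewrite -leNgt -ltNge => /(sD _ _ (coupling_mem cP uc))/ltW.
by rewrite -mulrA ler_pM2l//; lra.
Qed.

Lemma kantorovich_sub_L1 :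
  metric_open (kantorovich D) `<=` metric_open (L1_dist D).
Proof.
apply: metric_open_sub => x e e0; exists e => // y; apply: le_lt_trans.
have [bs _ cP] := coupling_exists x y.
by rewrite (L1_dist_coupling DP cP); exact: kantorovich_coupling.
Qed.

Lemma L1_sub_measure : bounded_metric D ->
  metric_open (L1_dist D) `<=` conv_in_measure_open D.
Proof.
move=> [M0 DM0]; pose M := Num.max M0 1.
have DM p q : D p q <= M by rewrite le_max DM0.
have M1 : 1 <= M by rewrite le_max lexx orbT.
move=> U oU x Ux; have [e e0 eU] := oU x Ux.
have r0 : 0 < e / (2 * M) by rewrite divr_gt0// mulr_gt0//; lra.
exists (e / (2 * M)) => // y; have [bs _ cP] := coupling_exists x y.
rewrite (measure_exceed _ _ cP) lte_fin => bad_r; apply: eU.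
rewrite (L1_dist_coupling DP cP).
have := @wsum_le_exceed _ _ (couples bs) (fun q => D q.1 q.2)
  (fun q => e / (2 * M) < D q.1 q.2) (e / (2 * M)) M (coupling_ge0 cP).
have M0' : 0 <= M by lra.
rewrite (coupling_sum1 cP) => /(_ (lexx _) (ltW r0) M0') cost.
apply: le_lt_trans (cost _ _) _ => [u uc|u uc|].
- by rewrite -leNgt.
- exact: DM.
have rM : M * (e / (2 * M)) = e / 2 by field; lra.
have : M * \sum_(u <- couples bs | e / (2 * M) < D u.2.1 u.2.2) u.1 < e / 2.
  by rewrite -rM ltr_pM2l//; apply: lt_le_trans M1.
have : e / (2 * M) <= e / 2 by rewrite -rM ler_peMl// ltW.
by move=> le1 lt2; rewrite [ltRHS]splitr; exact: ler_ltD.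
Qed.

(** For each z, kantorovich_lower is applied to A |-> d(z, A) and to
    A |-> 1 - d(z, A); its bound does not depend on z. *)
Lemma norm_sub_kantorovich :
  metric_open (fun x y => `|E x - E y|) `<=` metric_open (kantorovich D).
Proof.
apply: metric_open_sub => x e e0; have e30 : 0 < e / 3 by rewrite divr_gt0.
have [s s0 sh] := refine_finite (unzip2 x) hP hE e30.
have se0 : 0 < s * (e / 3) by rewrite mulr_gt0.
exists (s * (e / 3)) => // y xy.
have xy3 : s^-1 * kantorovich D x y <= e / 3.
  by rewrite mulrC ler_pdivrMr// mulrC ltW.
apply: (@le_lt_trans _ _ (2 * e / 3)); last by lra.
apply: norm_affine_le => [|z]; first by lra.
have gs A B : A \in unzip2 x -> D A B < s ->
    `|dist_set d z (K_set A) - dist_set d z (K_set B)| <= e / 3.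
  by move=> Ax /(sh _ _ Ax)/ltW; apply: le_trans; exact: dist_set_hausdorff.
have d01 A : 0 <= dist_set d z (K_set A) <= 1.
  by rewrite dist_set_ge0 ?dist_set_le1//; case: dX.
rewrite ler_norml; apply/andP; split.
  have := kantorovich_lower DP (x := x) y (g := fun A => 1 - dist_set d z A) e30 s0.
  have comp (w : realization R (K X)) :
      \sum_(u <- w) u.1 * (1 - dist_set d z u.2) =
      1 - \sum_(u <- w) u.1 * dist_set d z u.2.
    under eq_bigr do rewrite mulrBr mulr1.
    by rewrite sumrB reduced_sum1.
  rewrite !comp => H; suff : \sum_(u <- y) u.1 * dist_set d z u.2 -
      \sum_(u <- x) u.1 * dist_set d z u.2 <= s^-1 * kantorovich D x y + e / 3 by lra.
  apply: le_trans (H _ _); first by lra.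
    move=> A B Ax AB; have := gs A B Ax AB; rewrite ler_norml => /andP[? ?]; lra.
  by move=> A; have /andP[? ?] := d01 A; apply/andP; split; lra.
have := kantorovich_lower DP (x := x) y (g := fun A => dist_set d z A) e30 s0.
move=> H; apply: le_trans (H _ d01) _; last by lra.
by move=> A B Ax AB; have := gs A B Ax AB; rewrite ler_norml => /andP[].
Qed.

End comparison.

Section conclusion.
Context {R : realType} {X : topologicalType}.

Lemma open_initial_emb (d : unit_metric R X) :
  @open (initial_topology (emb d)) = metric_open (hausdorff d).
Proof.
rewrite open_initial_norm; congr metric_open.
by apply/funext => A; apply/funext => B; exact: norm_embB.
Qed.

Lemma induced_openE (d : unit_metric R X) : induced_open d =
  metric_open (fun x y => `|affine_ext (emb d) x - affine_ext (emb d) y|).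
Proof. exact: open_initial_norm. Qed.

Lemma induced_open_measure (d : unit_metric R X) (D : K X -> K X -> R) :
  metrizes (metric_open (hausdorff d)) D -> induced_open d = conv_in_measure_open D.
Proof.
move=> DX; rewrite induced_openE; apply/seteqP; split.
  exact: norm_sub_measure.
exact: measure_sub_norm.
Qed.

(** The inclusions norm <= Kantorovich <= L1 <= measure <= norm close up. *)
Lemma induced_open_L1_kantorovich (d : unit_metric R X) (D : K X -> K X -> R) :
  metrizes (metric_open (hausdorff d)) D -> bounded_metric D ->
  induced_open d = metric_open (L1_dist D) /\
  induced_open d = metric_open (kantorovich D).
Proof.
move=> DX Db.
have L1_induced : metric_open (L1_dist D) `<=` induced_open d.
  by rewrite (induced_open_measure DX); exact: L1_sub_measure DX Db.
have induced_kan : induced_open d `<=` metric_open (kantorovich D).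
  by rewrite induced_openE; exact: norm_sub_kantorovich.
have kan_L1 := kantorovich_sub_L1 DX.
split; apply/seteqP; split => //.
- exact: subset_trans induced_kan kan_L1.
- exact: subset_trans kan_L1 L1_induced.
Qed.

End conclusion.
Unset Implicit Arguments.

Theorem theorem2 (R : realType) (X : topologicalType) :
  metrizable R X ->
  [/\ forall d : unit_metric R X,
        [/\ injective (emb d),
            @open (initial_topology (emb d)) =
              metric_open (hausdorff d),
            forall A : K X, affine_ext (emb d) (vertex R A) = emb d A,
            forall (s : seq (R * K X)) (sc : chain_sum s),
              affine_ext (emb d) (formal_sum sc) =
              \sum_(u <- s) u.1 *: emb d u.2 &
            injective (affine_ext (R := R) (emb d))],
      forall d d' : unit_metric R X, induced_open d = induced_open d' &
      forall d : unit_metric R X,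
      forall d0 : X -> X -> R, metrizes open d0 ->
      forall D : K X -> K X -> R,
        metrizes (metric_open (hausdorff d0)) D ->
        induced_open d = conv_in_measure_open D /\
        (bounded_metric D ->
           induced_open d = metric_open (L1_dist D) /\
           induced_open d = metric_open (kantorovich D))].
Proof.
move=> _; split=> [d|d d'|d d0 d0X D].
- split.
  + move=> A B AB; apply: (dist_set_inj (unit_metricP d)) => x.
    by have := congr1 (fun f : Cb R X => f x) AB.
  + exact: open_initial_emb.
  + exact: affine_emb_vertex.
  + exact: affine_emb_formal_sum.
  + exact: affine_emb_inj.
- have d'h := hausdorff_is_metric (unit_metricP d').
  rewrite (induced_open_measure (D := hausdorff d') (d := d)).
    by rewrite (induced_open_measure (D := hausdorff d') (d := d')).
  split=> //; apply: metric_open_hausdorff; exact: unit_metricP.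
- rewrite (metric_open_hausdorff d0X (unit_metricP d)) => DX.
  split; first exact: induced_open_measure.
  exact: induced_open_L1_kantorovich.
Qed.
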